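(* Let $d\geq 3$, let $\gamma_d=(d-1)^{1/d}$ and $\omega=d(d-1)^{-(d-1)/d}$. For $N\geq 1$ and $C\geq 0$ define, for $q$ sufficiently large, \[ \psi_{N,C}(q)=q^{\,-\omega+\frac{d\gamma_d\log^2(\gamma_d)}{8}\left[\sum_{n=2}^{N}\prod_{i=2}^{n}\left(\frac{1}{\log^{(i)}(q)}\right)^2 + C\prod_{i=2}^{N+1}\left(\frac{1}{\log^{(i)}(q)}\right)^2\right]}, \] where $\log^{(i)}$ is the $i$th iterate of $\log$ and the first sum is $0$ when $N=1$. Then $\psi_{N,C}$ is Dirichlet on $\mathbb{R}^d$ with respect to $H_{\max}$ if and only if $C>1$; moreover, when it is Dirichlet it is not optimally Dirichlet.
   Context: Let $\|\cdot\|$ be the max norm on $\mathbb{R}^d$. $H_{\max}(p_1/q_1,\ldots,p_d/q_d)=\max(q_1,\ldots,q_d)$ for reduced fractions with $q_i\geq1$. (The number $\omega=d(d-1)^{-(d-1)/d}$ is the exponent of irrationality $\omega_d(H_{\max})$.) For $\psi$ with positive values (defined for large arguments, extended arbitrarily to $\mathbb{N}$) and $\mathbf{x}\in\mathbb{R}^d$, $C_{H,\psi}(\mathbf{x})=\liminf_{\mathbf{r}\in\mathbb{Q}^d,\ \mathbf{r}\to\mathbf{x}}\frac{\|\mathbf{x}-\mathbf{r}\|}{\psi(H(\mathbf{r}))}$. $\psi$ is Dirichlet with respect to $H$ if $C_{H,\psi}(\mathbf{x})<\infty$ for all $\mathbf{x}\in\mathbb{R}^d\setminus\mathbb{Q}^d$,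 and optimally Dirichlet if moreover $C_{H,\psi}(\mathbf{x})>0$ for some $\mathbf{x}\in\mathbb{R}^d\setminus\mathbb{Q}^d$. *)

(* Defs.v *)
From mathcomp Require Import all_boot all_order all_algebra.
From mathcomp Require Import all_classical all_reals all_analysis.
Set Implicit Arguments.
Unset Strict Implicit.
Unset Printing Implicit Defensive.
Import Order.TTheory GRing.Theory Num.Theory.
Import numFieldNormedType.Exports.
Local Open Scope classical_set_scope.
Local Open Scope ring_scope.

Definition ratv (R : realType) (d : nat) (r : 'rV[rat]_d) : 'rV[R]_d :=
  map_mx ratr r.

Definition irrational_points (R : realType) (d : nat) : set 'rV[R]_d :=
  ~` range (@ratv R d).

(* [denq] is the positive denominator of the reduced fraction. *)
Definition Hmax (d : nat) (r : 'rV[rat]_d) : nat :=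
  (\max_(i < d) `|denq (r ord0 i)|)%N.

(* Q^d with the topology induced from R^d; [limf_einf] needs a topological
   domain. *)
Definition ratpoint (R : realType) (d : nat) := initial_topology (@ratv R d).

(* The filter "r tends to x" on rational points. The point r = x is not removed,
   which is immaterial for irrational x. *)
Definition rat_nbhs (R : realType) (d : nat) (x : 'rV[R]_d) :
    set_system (ratpoint R d) :=
  filter_from (nbhs x) (fun U => @ratv R d @^-1` U).

(* [`| _ |] on ['rV[R]_d] is the max norm. *)
Definition approx_const (R : realType) (d : nat) (H : 'rV[rat]_d -> nat)
    (psi : nat -> R) (x : 'rV[R]_d) : \bar R :=
  limf_einf (fun r : ratpoint R d => (`|x - ratv R r| / psi (H r))%:E)
    (rat_nbhs x).

Definition dirichlet (R : realType) (d : nat) (H : 'rV[rat]_d -> nat)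
    (psi : nat -> R) : Prop :=
  forall x : 'rV[R]_d,
    irrational_points x -> (approx_const H psi x < +oo)%E.

Definition optimally_dirichlet (R : realType) (d : nat)
    (H : 'rV[rat]_d -> nat) (psi : nat -> R) : Prop :=
  dirichlet H psi /\
  exists2 x : 'rV[R]_d,
    irrational_points x & (0 < approx_const H psi x)%E.

Definition gamma_d (R : realType) (d : nat) : R :=
  (d%:R - 1) `^ (d%:R^-1).

Definition omega_d (R : realType) (d : nat) : R :=
  d%:R * (d%:R - 1) `^ (- ((d%:R - 1) / d%:R)).

Definition iter_log (R : realType) (i : nat) (q : R) : R := iter i (@ln R) q.

Definition inv_log_prod (R : realType) (n : nat) (q : R) : R :=
  \prod_(2 <= i < n.+1) (1 / iter_log i q) ^+ 2.

(* [ln] and [powR] are total, so this is defined for every q, but it is only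
   meaningful once all the iterated logarithms involved are positive. *)
Definition psi_NC (R : realType) (d N : nat) (C q : R) : R :=
  q `^ (- omega_d R d
        + d%:R * gamma_d R d * ln (gamma_d R d) ^+ 2 / 8
          * (\sum_(2 <= n < N.+1) inv_log_prod n q
             + C * inv_log_prod N.+1 q)).

(* Main.v *)
Require Import Defs.
From mathcomp Require Import all_boot all_order all_algebra.
From mathcomp Require Import all_classical all_reals all_analysis.
From mathcomp Require Import ring lra zify.
Import Order.TTheory GRing.Theory Num.Theory.
Import numFieldNormedType.Exports.
Local Open Scope classical_set_scope.
Local Open Scope ring_scope.

(* Write m = d - 1, gamma = gamma_d (so gamma^d = m), theta = ln gamma, and pass
   to logarithms t = ln q; then - ln psi = omega t (1 - (m theta^2 / 2) Q (ln t))
   where 4 Q is the bracket in the exponent of psi_{N,C}. Coordinates are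
   approximated independently, so x is badly approximable iff, along the sequence
   t_0 < t_1 < ... of log-denominators of best approximations, at each time some
   coordinate satisfies (last log-denominator) + (next one) <= - ln psi + O(1).
   The extremal configuration uses the coordinates cyclically, which gives the
   delay inequality t_{k+1} + t_{k-m} <= - ln psi (t_k). At the exponent omega its
   characteristic equation has the double root gamma, and y_k = t_k / gamma^k is
   governed by the difference analogue of y'' + theta^2 Q y <= 0. Here
   4 Q = 1/s^2 + 1/(s ln s)^2 + ... is the Kneser-Hille scale, on which positive
   solutions exist iff the last coefficient C is at most 1. *)

(** * Iterated logarithms *)

(** A constant factor in psi only adds a constant to - ln psi, whereas changing C moves - ln psi by
    more than any multiple of t / (ln t)^3. The errors of the argument are either additive constants
    or perturbations of Q of size O(s^-3), where s = ln t, so they are paid for by lowering kappa =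
    (C - 1) / 4 when C > 1, and by one further logarithmic level when C = 1. This is also why no
    optimal case exists: the liminf vanishes at every irrational point when C > 1, and is infinite
    at some point when C <= 1. The obstacle for C > 1 is that nothing prescribes the order in which
    the coordinates are used. Other orders are excluded beforehand by a convexity argument that
    needs only the exponent omega. The constant m theta^2 / 2 comes from a Taylor expansion: m
    y_{k+m+1} - (m+1) y_{k+m} + y_k is about m (m+1) / 2 times y'', while one step in k is a step
    theta in s. *)

Lemma near_pinfty_ge (R : realType) (A : R) : \forall s \near +oo, A <= s.
Proof. exact: (nbhs_pinfty_ge (num_real A)). Qed.

Lemma ler_lnM (R : realType) (s s' : R) : 0 < s -> s <= s' -> ln s <= ln s'.
Proof. by move=> s0 ss'; rewrite ler_ln ?posrE// (lt_le_trans s0). Qed.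

Lemma ge_expR_ln (R : realType) (A s : R) : expR A <= s -> A <= ln s.
Proof.
move=> As; rewrite -[A]expRK ler_lnM ?expR_gt0//.
Qed.

Lemma near_pinfty_ln (R : realType) (P : R -> Prop) :
  (\forall s \near +oo, P s) -> \forall s \near +oo, P (ln s).
Proof.
move=> [M [Mr MP]]; near=> s.
apply: MP; apply: (@lt_le_trans _ _ (M + 1)); first by rewrite ltrDl.
by apply: ge_expR_ln; near: s; apply: near_pinfty_ge.
Unshelve. all: by end_near. Qed.

Lemma near_pinfty_ln_ge (R : realType) (A : R) : \forall s \near +oo, A <= ln s.
Proof. exact: (near_pinfty_ln _ (fun v => A <= v) (near_pinfty_ge _ A)). Qed.

(** The cube is the size at stake: errors are [O(s^-3)], and through [cube_dominated_ln] they become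
    negligible against the logarithmic scale at any depth. *)
Lemma near_ln_cube (R : realType) (A : R) :
  \forall s \near +oo, A * ln s ^+ 3 <= s.
Proof.
near=> s.
have s0 : 0 < s by near: s; apply: (nbhs_pinfty_gt (num_real _)).
set v := ln s.
have v0 : 0 <= v by rewrite /v; near: s; apply: near_pinfty_ln_ge.
have vA : 256 * A <= v by rewrite /v; near: s; apply: near_pinfty_ln_ge.
have -> : s = expR v by rewrite lnK// posrE.
have -> : v = v / 4 * 4%:R by field.
rewrite expRM_natr.
apply: (@le_trans _ _ ((v / 4) ^+ 4)).
  have -> : A * (v / 4 * 4) ^+ 3 = v ^+ 3 * A by field.
  have -> : (v / 4) ^+ 4 = v ^+ 3 * (v / 256) by field.
  by rewrite ler_wpM2l ?exprn_ge0//; lra.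
rewrite lerXn2r ?nnegrE ?expR_ge0 ?divr_ge0//.
by apply: le_trans (expR_ge1Dx _); lra.
Unshelve. all: by end_near. Qed.

(** The potential [Q] of [y'' + Q y = 0]. The recursion is the Liouville transformation: putting
    [y = sqrt s * z] and [v = ln s] gives [z'' + P z = 0] in [v], where
    [Q s = (1/4 + P (ln s)) / s^2]. At the bottom the potential is the constant [kappa], so the
    threshold is [kappa = 0]. *)
Fixpoint logq (R : realType) (kappa : R) (N : nat) (s : R) : R :=
  if N is N'.+1 then (4^-1 + logq R kappa N' (ln s)) / s ^+ 2 else kappa.
Arguments logq {R}.

Lemma logq_ge0 (R : realType) (kappa : R) (N : nat) (s : R) :
  0 <= kappa -> 0 <= logq kappa N s.
Proof.
move=> k0; elim: N s => [//|N IH] s /=.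
by rewrite divr_ge0 ?sqr_ge0// addr_ge0// invr_ge0.
Qed.

Lemma logq_noninc (R : realType) (kappa : R) (N : nat) : 0 <= kappa ->
  \forall s \near +oo, forall s', s <= s' -> logq kappa N s' <= logq kappa N s.
Proof.
move=> k0; elim: N => [|N IH]; first by near=> s.
near=> s => s' ss' /=.
have s0 : 0 < s by near: s; apply: (nbhs_pinfty_gt (num_real _)).
have s'0 : 0 < s' by apply: lt_le_trans ss'.
apply: ler_pM.
- by rewrite addr_ge0 ?logq_ge0// invr_ge0.
- by rewrite invr_ge0 sqr_ge0.
- rewrite lerD2l; have := ler_lnM _ _ _ s0 ss'; move: (ln s').
  by near: s; apply: (near_pinfty_ln _ _ IH).
- by rewrite lef_pV2 ?posrE ?exprn_gt0// lerXn2r// nnegrE ltW.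
Unshelve. all: by end_near. Qed.

(** The decay like [s^-2] keeps the potential nonincreasing even after multiplication by a solution
    that grows at most linearly. *)
Lemma logq_sqr_noninc (R : realType) (kappa : R) (N : nat) : 0 <= kappa ->
  \forall s \near +oo, forall s', s <= s' ->
    s' ^+ 2 * logq kappa N.+1 s' <= s ^+ 2 * logq kappa N.+1 s.
Proof.
move=> k0; near=> s => s' ss' /=.
have s0 : 0 < s by near: s; apply: (nbhs_pinfty_gt (num_real _)).
have s'0 : 0 < s' by apply: lt_le_trans ss'.
rewrite mulrC divfK ?expf_neq0 ?gt_eqF// mulrC divfK ?expf_neq0 ?gt_eqF//.
rewrite lerD2l; have := ler_lnM _ _ _ s0 ss'; move: (ln s').
by near: s; apply: (near_pinfty_ln _ _ (logq_noninc _ _ N k0)).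
Unshelve. all: by end_near. Qed.

Lemma logq_bounded (R : realType) (kappa : R) (N : nat) : 0 <= kappa ->
  exists2 A, 0 < A & \forall s \near +oo, logq kappa N s <= A.
Proof.
move=> k0; have [M _ MP] := pinfty_ex_gt0 (logq_noninc _ _ N k0).
exists (logq kappa N M + 1); first by rewrite ltr_wpDl ?logq_ge0.
near=> s; apply: (@le_trans _ _ (logq kappa N M)); last by rewrite lerDl.
by apply: MP; near: s; apply: near_pinfty_ge.
Unshelve. all: by end_near. Qed.

Lemma logq_le_sqr (R : realType) (kappa : R) (N : nat) : 0 <= kappa ->
  exists2 A, 0 < A & \forall s \near +oo, logq kappa N.+1 s <= A / s ^+ 2.
Proof.
move=> k0; have [A A0 AP] := logq_bounded _ _ N k0.
exists (4^-1 + A); first by rewrite addr_gt0// invr_gt0.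
near=> s => /=; rewrite ler_wpM2r ?invr_ge0 ?sqr_ge0// lerD2l.
by near: s; apply: (near_pinfty_ln _ _ AP).
Unshelve. all: by end_near. Qed.

Lemma logq_le (R : realType) (kappa : R) (N : nat) (e : R) :
  0 <= kappa -> 0 < e -> \forall s \near +oo, logq kappa N.+1 s <= e.
Proof.
move=> k0 e0; have [A A0 AP] := logq_le_sqr _ _ N k0.
near=> s; apply: (@le_trans _ _ (A / s ^+ 2)); first by near: s.
have s1 : 1 <= s by near: s; apply: near_pinfty_ge.
have s0 : 0 < s by apply: lt_le_trans s1.
rewrite ler_pdivrMr ?exprn_gt0// mulrC -ler_pdivrMr//.
apply: (@le_trans _ _ s); first by near: s; apply: near_pinfty_ge.
by rewrite expr2 ler_peMl// ltW.
Unshelve. all: by end_near. Qed.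

Lemma cube_dominated_ln (R : realType) (D : R -> R) :
  (forall A, \forall s \near +oo, A / s ^+ 3 <= D s) ->
  forall A, \forall s \near +oo, A / s ^+ 3 <= D (ln s) / s ^+ 2.
Proof.
move=> DP A; near=> s.
have s0 : 0 < s by near: s; apply: (nbhs_pinfty_gt (num_real _)).
have v0 : 0 < ln s.
  apply: (@lt_le_trans _ _ 1) => //.
  by near: s; apply: near_pinfty_ln_ge.
apply: (@le_trans _ _ (1 / ln s ^+ 3 / s ^+ 2)); last first.
  rewrite ler_wpM2r ?invr_ge0 ?sqr_ge0//.
  by near: s; apply: (near_pinfty_ln _ _ (DP 1)).
rewrite exprSr invfM mulrA mulrAC ler_wpM2r ?invr_ge0 ?sqr_ge0//.
rewrite ler_pdivrMr// mulrAC ler_pdivlMr ?exprn_gt0// mul1r.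
by near: s; apply: near_ln_cube.
Unshelve. all: by end_near. Qed.

(** This gap between two values of the innermost coefficient pays for the errors when [C > 1]. *)
Lemma logq_gap (R : realType) (kappa kappa' : R) (N : nat) (A : R) :
  kappa' < kappa ->
  \forall s \near +oo, A / s ^+ 3 <= logq kappa N s - logq kappa' N s.
Proof.
move=> kk; elim: N A => [|N IH] A.
  near=> s => /=.
  have s1 : 1 <= s by near: s; apply: near_pinfty_ge.
  have s0 : 0 < s by apply: lt_le_trans s1.
  have kk0 : 0 < kappa - kappa' by rewrite subr_gt0.
  rewrite ler_pdivrMr ?exprn_gt0// mulrC -ler_pdivrMr//.
  apply: (@le_trans _ _ s); first by near: s; apply: near_pinfty_ge.
  by rewrite exprS ler_peMr ?exprn_ege1 ?ltW.
have := cube_dominated_ln _ _ IH A.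
by apply: filterS => s /=; rewrite -mulrBl opprD addrACA subrr add0r.
Unshelve. all: by end_near. Qed.

(** At [kappa = 0] the next level of the scale takes over the role of the gap. *)
Lemma logq0_gap (R : realType) (N : nat) (A : R) :
  \forall s \near +oo, A / s ^+ 3 <= logq (0 : R) N.+1 s - logq 0 N s.
Proof.
elim: N A => [|N IH] A.
  near=> s => /=.
  have s0 : 0 < s by near: s; apply: (nbhs_pinfty_gt (num_real _)).
  rewrite addr0 subr0 exprSr invfM mulrA mulrAC.
  rewrite ler_wpM2r ?invr_ge0 ?sqr_ge0//.
  rewrite ler_pdivrMr//.
  have : 4 * A <= s by near: s; apply: near_pinfty_ge.
  lra.
have := cube_dominated_ln _ _ IH A.
apply: filterS => s; rewrite [logq _ N.+2 _]/= [logq _ N.+1 (ln s)]/=.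
by rewrite /= -mulrBl opprD addrACA subrr add0r.
Unshelve. all: by end_near. Qed.

(** * Discrete Riccati inequalities *)

Lemma ln_sub_le (R : realType) (s s' : R) : 0 < s -> 0 < s' ->
  ln s' - ln s <= (s' - s) / s.
Proof.
move=> s0 s'0; rewrite -ln_div ?posrE//.
have -> : s' / s = 1 + (s' - s) / s by field; rewrite gt_eqF.
apply: le_ln1Dx; rewrite mulrBl divff ?gt_eqF//.
by have : 0 < s' / s := divr_gt0 s'0 s0; lra.
Qed.

(** The logarithmic derivative of [sqrt (s * ln s * ln ln s * ...)] with [N] factors, a positive
    solution of [y'' + logq 0 N y = 0]. *)
Fixpoint barrier (R : realType) (N : nat) (s : R) : R :=
  if N is N'.+1 then (2^-1 + barrier R N' (ln s)) / s else 0.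
Arguments barrier {R}.

Lemma barrier_bounds (R : realType) (N : nat) :
  \forall s \near +oo, 0 <= barrier N (s : R) <= 2^-1.
Proof.
elim: N => [|N IH]; first by near=> s; rewrite /= lexx invr_ge0 ler0n.
near=> s => /=.
have s2 : 2 <= s by near: s; apply: near_pinfty_ge.
have s0 : 0 < s by apply: lt_le_trans s2.
have /andP[b0 b1] : 0 <= barrier N (ln s) <= 2^-1.
  by near: s; apply: (near_pinfty_ln _ _ IH).
apply/andP; split; last by rewrite ler_pdivrMr//; lra.
by rewrite divr_ge0 ?(ltW s0)// addr_ge0 ?invr_ge0.
Unshelve. all: by end_near. Qed.

Lemma barrierS_bounds (R : realType) (N : nat) :
  \forall s \near +oo, 0 < s * barrier N.+1 (s : R) <= 1.
Proof.
near=> s => /=.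
have s0 : 0 < s by near: s; apply: (nbhs_pinfty_gt (num_real _)).
have /andP[b0 b1] : 0 <= barrier N (ln s) <= 2^-1.
  by near: s; apply: (near_pinfty_ln _ _ (barrier_bounds R N)).
rewrite mulrC divfK ?gt_eqF//; apply/andP; split; lra.
Unshelve. all: by end_near. Qed.

(* The barrier solves the differential equation B' = - (B^2 + logq 0 N); the
   finite-difference form follows by induction from 1 - s/s' <= ln (s'/s). *)
Lemma barrier_step (R : realType) (N : nat) :
  \forall s \near +oo, forall s' : R, s <= s' ->
  barrier N s' + (s' - s) * (barrier N s' ^+ 2 + logq 0 N s') <= barrier N s.
Proof.
elim: N => [|N IH]; first by near=> s => s' ss' /=; rewrite expr0n/= !addr0 mulr0.
near=> s => s' ss' /=.
have s0 : 0 < s by near: s; apply: (nbhs_pinfty_gt (num_real _)).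
have s'0 : 0 < s' by apply: lt_le_trans ss'.
have : barrier N (ln s') + (ln s' - ln s) *
    (barrier N (ln s') ^+ 2 + logq 0 N (ln s')) <= barrier N (ln s).
  have := ler_lnM _ _ _ s0 ss'; move: (ln s').
  by near: s; apply: (near_pinfty_ln _ _ IH).
have /andP[] : 0 <= barrier N (ln s') <= 2^-1.
  move: s' ss' s'0; near: s.
  have [M' [_ MP']] := near_pinfty_ln _ _ (barrier_bounds R N).
  near=> s => s' ss' s'0; apply: MP'; apply: lt_le_trans ss'.
  by near: s; apply: (nbhs_pinfty_gt (num_real _)).
have := logq_ge0 _ 0 N (ln s') (lexx _).
move: (logq 0 N (ln s')) (barrier N (ln s')) (barrier N (ln s)) => p b' b.
move=> p0 b'0 _ hb.
have hl : (s' - s) / s' <= ln s' - ln s.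
  have := ln_sub_le _ _ _ s'0 s0.
  by rewrite -[ln s - _]opprB -[s - s']opprB mulNr lerN2.
have {}hb : b' + (s' - s) / s' * (b' ^+ 2 + p) <= b.
  by apply: le_trans hb; rewrite lerD2l ler_wpM2r// addr_ge0// sqr_ge0.
apply: (@le_trans _ _ ((2^-1 + (b' + (s' - s) / s' * (b' ^+ 2 + p))) / s)); last first.
  by rewrite ler_wpM2r ?invr_ge0 ?(ltW s0)// lerD2l.
rewrite -subr_ge0.
(* The discretization error has a sign: it is a square times nonnegative terms. *)
have -> : (2^-1 + (b' + (s' - s) / s' * (b' ^+ 2 + p))) / s -
   ((2^-1 + b') / s' + (s' - s) * (((2^-1 + b') / s') ^+ 2 + (4^-1 + p) / s' ^+ 2)) =
   (s' - s) ^+ 2 * (2^-1 + b' + b' ^+ 2 + p) / (s * s' ^+ 2).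
  by field; rewrite !gt_eqF.
apply: divr_ge0; apply: mulr_ge0; rewrite ?sqr_ge0 ?(ltW s0)//.
by do 3?[apply: addr_ge0]; rewrite ?sqr_ge0 ?invr_ge0.
Unshelve. all: by end_near. Qed.

Lemma drift_ninfty (R : realType) (c : R) (s F : nat -> R) : 0 < c ->
  (forall A, \forall k \near \oo, A <= s k) ->
  (\forall k \near \oo, F k.+1 <= F k - (s k.+1 - s k) * c) ->
  forall A, \forall k \near \oo, F k <= A.
Proof.
move=> c0 soo [K _ FS] A; near=> k.
have Kk : (K <= k)%N by near: k; apply: nbhs_infty_ge.
have H : F k <= F K - (s k - s K) * c.
  rewrite -(subnKC Kk); elim: (k - K)%N => [|j IH].
    by rewrite addn0 subrr mul0r subr0.
  rewrite addnS; apply: (le_trans (FS (K + j)%N _)).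
    by rewrite /= leq_addr.
  lra.
apply: (le_trans H).
have : (F K + s K * c - A) / c <= s k by near: k; apply: soo.
rewrite ler_pdivrMr//; lra.
Unshelve. all: by end_near. Qed.

(* The substitution s |-> ln s, F |-> s * F - 1/2 turns the discrete Riccati
   inequality at depth N.+1 into the one at depth N. *)
Lemma riccati_ninfty (R : realType) (kappa : R) (N : nat) (s F : nat -> R) :
  0 < kappa ->
  (forall A, \forall k \near \oo, A <= s k) ->
  (\forall k \near \oo, s k <= s k.+1) ->
  (\forall k \near \oo,
    F k.+1 <= F k - (s k.+1 - s k) * (F k ^+ 2 + logq kappa N (s k))) ->
  forall A, \forall k \near \oo, F k <= A.
Proof.
move=> k0; elim: N s F => [|N IH] s F soo sm FS.
  apply: (drift_ninfty _ kappa s) => //.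
  near=> k; apply: (@le_trans _ _ (F k - (s k.+1 - s k) * (F k ^+ 2 + kappa))).
    by near: k.
  rewrite lerD2l lerN2 ler_wpM2l ?lerDr ?sqr_ge0// subr_ge0.
  by near: k.
pose good k := [/\ 0 < s k, s k <= s k.+1 &
  F k.+1 <= F k - (s k.+1 - s k) * (F k ^+ 2 + logq kappa N.+1 (s k))].
have sm' : \forall k \near \oo, good k.
  apply: filterS3 sm FS (soo 1) => k sk Fk sk1; split=> //.
  exact: lt_le_trans sk1.
(* The bound -1 is low enough to make [F] itself negative, since it gives [s k * F k <= - 1/2]. *)
have neg : \forall k \near \oo, s k * F k - 2^-1 <= -1.
  apply: (IH (fun k => ln (s k)) (fun k => s k * F k - 2^-1)).
  - move=> A; near=> k; apply: ge_expR_ln; near: k; exact: soo.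
  - near=> k; have [s0 ss' _] : good k by near: k.
    exact: ler_lnM.
  - near=> k; have [s0 ss'] : good k by near: k.
    have s'0 := lt_le_trans s0 ss'.
    have := ln_sub_le _ _ _ s0 s'0.
    rewrite /=; have := logq_ge0 _ _ N (ln (s k)) (ltW k0).
    move: (logq _ _ _) => p.
    move: (s k) (s k.+1) (F k) (F k.+1) s0 ss' s'0 => x x' f f' x0 xx' x'0 p0 hl hf.
    set f1 := x * f - 2^-1.
    have h1 : x' * f' - 2^-1 <= f1 - (x' - x) / x * (f1 ^+ 2 + p).
      apply: (@le_trans _ _
        (x' * (f - (x' - x) * (f ^+ 2 + (4^-1 + p) / x ^+ 2)) - 2^-1)).
        by rewrite lerD2r ler_wpM2l// ltW.
      rewrite -subr_ge0 /f1.
      (* Explicit differences have an error of the favourable sign here, as implicit ones do in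
         [barrier_step]. *)
      have -> : x * f - 2^-1 - (x' - x) / x * ((x * f - 2^-1) ^+ 2 + p) -
        (x' * (f - (x' - x) * (f ^+ 2 + (4^-1 + p) / x ^+ 2)) - 2^-1) =
        (x' - x) ^+ 2 * (f ^+ 2 + (4^-1 + p) / x ^+ 2).
        by field; rewrite gt_eqF.
      rewrite mulr_ge0 ?sqr_ge0// addr_ge0 ?sqr_ge0// divr_ge0 ?sqr_ge0//.
      by rewrite addr_ge0 ?invr_ge0.
    apply: (le_trans h1); rewrite lerD2l lerN2 ler_wpM2r// addr_ge0 ?sqr_ge0//.
have [K _ KP] : \forall k \near \oo, good k /\ s k * F k - 2^-1 <= -1.
  exact: filterS2 sm' neg.
have FK0 : F K < 0.
  have [[sK0 _ _] FK] := KP K (leqnn _).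
  rewrite -(pmulr_rlt0 _ sK0); lra.
(* From [K] on [F] is negative and nonincreasing, so [F k ^+ 2] never falls below [F K ^+ 2]: a
   constant drift. *)
apply: (drift_ninfty _ (F K ^+ 2) s) => //.
  by rewrite exprn_even_gt0//= lt_eqF.
exists K => // k /= Kk; have [[_ ss' +] _] := KP k Kk.
move=> /le_trans; apply; rewrite lerD2l lerN2 ler_wpM2l ?subr_ge0//.
apply: (@le_trans _ _ (F k ^+ 2)); last by rewrite lerDl logq_ge0// ltW.
have FkK : F k <= F K.
  rewrite -(subnKC Kk); elim: (k - K)%N => [|j IHj]; first by rewrite addn0.
  rewrite addnS; have [[_ ss'' hF] _] := KP (K + j)%N (leq_addr _ _).
  apply: (le_trans hF); apply: le_trans IHj.
  by rewrite gerBl mulr_ge0 ?subr_ge0// addr_ge0 ?sqr_ge0// logq_ge0// ltW.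
rewrite -[leLHS]sqrrN -[leRHS]sqrrN lerXn2r ?nnegrE; lra.
Unshelve. all: by end_near. Qed.

(** * The delay inequality has no positive solution when C > 1 *)

Lemma sum_succ (R : realType) (m : nat) :
  \sum_(j < m) j.+1%:R = m%:R * m.+1%:R / 2 :> R.
Proof.
elim: m => [|m IH]; first by rewrite big_ord0 !mul0r.
by rewrite big_ord_recr/= IH -!natr1; field.
Qed.

Lemma window_sumS (R : realType) (y : nat -> R) (m k : nat) :
  \sum_(j < m) y (k.+1 + j)%N = \sum_(j < m) y (k + j)%N + y (k + m)%N - y k.
Proof.
elim: m => [|m IH]; first by rewrite !big_ord0 addn0 add0r subrr.
by rewrite !big_ord_recr/= IH addnS addSn; ring.
Qed.

Lemma weighted_window_sumS (R : realType) (y : nat -> R) (m k : nat) :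
  \sum_(j < m) j.+1%:R * y (k.+1 + j)%N = \sum_(j < m) j.+1%:R * y (k + j)%N
    + (m%:R * y (k + m)%N - \sum_(j < m) y (k + j)%N).
Proof.
elim: m => [|m IH]; first by rewrite !big_ord0 mul0r subrr addr0.
by rewrite !big_ord_recr/= IH addnS addSn -!natr1; ring.
Qed.

Lemma linear_growth_window (R : realType) (y : nat -> R) (n j : nat) :
  (forall i, (n <= i < n + j)%N -> i.+1%:R * y i.+1 <= i.+2%:R * y i) ->
  n.+1%:R * y (n + j)%N <= (n + j).+1%:R * y n.
Proof.
elim: j => [|j IH] H; first by rewrite addn0.
have {}IH : n.+1%:R * y (n + j)%N <= (n + j).+1%:R * y n.
  by apply: IH => i /andP[ni ij]; apply: H; rewrite ni addnS ltnW.
have := H (n + j)%N; rewrite leq_addr addnS ltnSn => /(_ isT) Hj.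
rewrite -(@ler_pM2l _ (n + j).+1%:R) ?ltr0n//.
rewrite mulrCA (le_trans (ler_wpM2l (ler0n _ _) Hj))//.
by rewrite mulrCA [leRHS]mulrCA ler_wpM2l ?ler0n.
Qed.

(* y n = n + 1 solves the recurrence with equality. *)
Lemma linear_growth (R : realType) (m : nat) (y : nat -> R) : (0 < m)%N ->
  (forall n, 0 < y n) ->
  (forall n, m%:R * y n.+1 <= m.+1%:R * y n) ->
  (forall n, m%:R * y (n + m).+1 + y n <= m.+1%:R * y (n + m)%N) ->
  forall n, n.+1%:R * y n.+1 <= n.+2%:R * y n.
Proof.
move=> m0 y0 yS yrec; elim/ltn_ind => i IH.
have mR : 0 < m%:R :> R by rewrite ltr0n.
case: (ltnP i m) => im.
  (* For [i < m] the single-step bound suffices, as [(m + 1) / m <= (i + 2) / (i + 1)]. *)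
  have := yS i; rewrite -(@ler_pM2l _ i.+1%:R) ?ltr0n// => H.
  rewrite -(@ler_pM2l _ m%:R)// mulrCA; apply: (le_trans H).
  rewrite !mulrA ler_wpM2r ?(ltW (y0 _))// -!natrM ler_nat; nia.
have -> : i = (i - m + m)%N by rewrite subnK.
set n := (i - m)%N.
(* The growth known so far bounds the delayed term [y n] below; the recurrence then returns exactly
   the ratio [(n + m + 2) / (n + m + 1)]. *)
have W : n.+1%:R * y (n + m)%N <= (n + m).+1%:R * y n.
  apply: linear_growth_window => l /andP[nl lm]; apply: IH.
  by rewrite /n in lm; lia.
have := yrec n; rewrite -(@ler_pM2l _ (n + m).+1%:R) ?ltr0n// => H.
rewrite -(@ler_pM2l _ m%:R)//.
move: H W; rewrite -!natr1 !natrD; lra.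
Qed.

(** The four errors are [f^3], the excess [x] of the step over [theta] set against [f^2] and against
    [q'], and the window correction [m x]. Each is [O(s^-3)]; [A] collects their constants. *)
Lemma riccati_error (R : realType) (theta m L B A f x q q' s delta : R) :
  0 < theta -> 0 <= m -> 0 < s -> 0 <= f <= x -> x <= L / s ->
  delta <= theta + x -> 0 <= q' <= q -> q <= B / s ^+ 2 ->
  A * theta = L ^+ 3 / theta + L ^+ 3 / theta ^+ 2 + L * B + theta * m * L * B ->
  A / s ^+ 3 <= q - q' ->
  (f - f ^+ 2 + f ^+ 3 - theta ^+ 2 * q * (1 - m * x)) / theta <=
  f / theta - delta * ((f / theta) ^+ 2 + q').
Proof.
move=> th0 m0 s0 /andP[f0 fx] xh dx /andP[q'0 q'q] qB defA gap.
set h := L / s in xh.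
set b := B / s ^+ 2 in qB.
have x0 : 0 <= x by apply: le_trans fx.
have q0 : 0 <= q by apply: le_trans q'q.
have fh : f <= h by apply: le_trans xh.
have h0 : 0 <= h by apply: le_trans fh.
have t20 : 0 < theta ^+ 2 by rewrite exprn_gt0.
have {}gap : h ^+ 3 / theta + h ^+ 3 / theta ^+ 2 + h * b + theta * m * (h * b)
    <= theta * (q - q').
  have -> : h ^+ 3 / theta + h ^+ 3 / theta ^+ 2 + h * b + theta * m * (h * b)
    = theta * (A / s ^+ 3).
    rewrite [RHS]mulrA [theta * A]mulrC defA /h /b.
    by field; rewrite !gt_eqF.
  by rewrite ler_wpM2l ?(ltW th0).
have i1 : f ^+ 3 / theta <= h ^+ 3 / theta.
  by rewrite ler_wpM2r ?invr_ge0 ?(ltW th0)// lerXn2r ?nnegrE.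
have i2 : x * f ^+ 2 / theta ^+ 2 <= h ^+ 3 / theta ^+ 2.
  rewrite ler_wpM2r ?invr_ge0 ?(ltW t20)// [h ^+ 3]exprS ler_pM ?sqr_ge0//.
  by rewrite lerXn2r ?nnegrE.
have i3 : x * q' <= h * b by rewrite ler_pM// (le_trans q'q).
have i4 : theta * m * (x * q) <= theta * m * (h * b).
  by rewrite ler_wpM2l ?mulr_ge0 ?(ltW th0)// ler_pM.
apply: (@le_trans _ _ (f / theta - (theta + x) * ((f / theta) ^+ 2 + q'))); last first.
  by rewrite lerD2l lerN2 ler_wpM2r// addr_ge0// sqr_ge0.
rewrite -subr_ge0.
have -> : f / theta - (theta + x) * ((f / theta) ^+ 2 + q') -
  (f - f ^+ 2 + f ^+ 3 - theta ^+ 2 * q * (1 - m * x)) / theta =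
  theta * (q - q') - (f ^+ 3 / theta + x * f ^+ 2 / theta ^+ 2 + x * q'
    + theta * m * (x * q)).
  by field; rewrite gt_eqF.
rewrite subr_ge0; apply: le_trans gap.
by rewrite !lerD.
Qed.

(* The sums Y k of (j+1) y (k+j) over j < m absorb the delay: their second
   difference is exactly m y (k+m+1) - (m+1) y (k+m) + y k, so F = (Y' - Y) / Y
   satisfies an undelayed Riccati inequality up to an O(s^-3) error, which is
   paid for by halving kappa. *)
Lemma delay_oscillation (R : realType) (kappa theta : R) (N m : nat)
    (y u : nat -> R) :
  0 < kappa -> 0 < theta -> (0 < m)%N ->
  (forall n, 0 < y n) ->
  (forall n, u n.+1 - u n = theta + ln (y n.+1) - ln (y n)) ->
  (forall n, u n <= u n.+1) ->
  (forall A, \forall n \near \oo, A <= u n) ->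
  (forall n, n.+1%:R * y n.+1 <= n.+2%:R * y n) ->
  (forall n, m%:R * y (n + m).+1 + y n <= m.+1%:R * y (n + m)%N *
     (1 - m%:R * theta ^+ 2 / 2 * logq kappa N.+1 (u (n + m)%N))) ->
  False.
Proof.
move=> k0 th0 m0 y0 hu um uoo grow rec.
have mR : 0 < m%:R :> R by rewrite ltr0n.
pose Y k := \sum_(j < m) j.+1%:R * y (k + j)%N.
pose G k := m%:R * y (k + m)%N - \sum_(j < m) y (k + j)%N.
pose M : R := m%:R * m.+1%:R / 2.
have M0 : 0 < M by rewrite divr_gt0 ?mulr_gt0 ?ltr0n.
have YS k : Y k.+1 = Y k + G k by rewrite /Y weighted_window_sumS.
have q0 k : 0 <= logq kappa N.+1 (u k) by apply: logq_ge0; apply: ltW.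
have GS k : G k.+1 <=
    G k - theta ^+ 2 * logq kappa N.+1 (u (k + m)%N) * (M * y (k + m)%N).
  rewrite /G window_sumS addSn /M; have := rec k.
  by rewrite -!natr1; lra.
have Gle k : G k.+1 <= G k.
  apply: (le_trans (GS k)); rewrite gerBl.
  by apply: mulr_ge0; apply: mulr_ge0; rewrite ?sqr_ge0 ?q0 ?(ltW M0) ?(ltW (y0 _)).
have Y0 k : 0 < Y k.
  rewrite /Y; case: (m) m0 => // m' _; rewrite big_ord_recl.
  rewrite ltr_pwDl ?mulr_gt0 ?ltr0n ?y0// sumr_ge0// => j _.
  by rewrite mulr_ge0 ?ler0n ?(ltW (y0 _)).
(* [Y] is positive and concave: a negative slope would persist and make it negative. *)
have G0 k : 0 <= G k.
  rewrite leNgt; apply/negP => Gk.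
  have H j : G (k + j)%N <= G k /\ Y (k + j)%N <= Y k + j%:R * G k.
    elim: j => [|j [IH1 IH2]]; first by rewrite addn0 mul0r addr0.
    rewrite addnS; split; first exact: le_trans (Gle _) _.
    rewrite YS -natr1; lra.
  have [_] := H (Num.bound (Y k / - G k)).
  have : Y k / - G k < (Num.bound (Y k / - G k))%:R.
    by apply: archi_boundP; rewrite divr_ge0 ?ltW// oppr_gt0.
  rewrite ltr_pdivrMr ?oppr_gt0// => H1 H2.
  have := Y0 (k + Num.bound (Y k / - G k))%N; lra.
(* Concavity again: the slope is at most that of the chord from 0, whence [F k <= 1 / k]. *)
have kG k : k%:R * G k <= Y k.
  elim: k => [|k IH]; first by rewrite mul0r ltW.
  rewrite YS; apply: (@le_trans _ _ (k.+1%:R * G k)).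
    by rewrite ler_wpM2l ?ler0n.
  by rewrite -natr1; lra.
have Ymono k j : Y k <= Y (k + j)%N.
  elim: j => [|j IH]; first by rewrite addn0.
  by rewrite addnS YS (le_trans IH)// lerDl.
(* The recurrence speaks of [y (k + m)], the Riccati form of [Y k.+1]; linear growth exchanges them
   up to a factor [1 - m / k]. *)
have My k : (k%:R - m%:R) * Y k.+1 <= k%:R * (M * y (k + m)%N).
  have H1 : (k + m).+1%:R * Y (k + m)%N <= (k + m + m)%:R * (M * y (k + m)%N).
    rewrite /M -sum_succ /Y mulr_sumr mulr_suml mulr_sumr.
    apply: ler_sum => j _; rewrite mulrCA [leRHS]mulrCA ler_wpM2l ?ler0n//.
    have := linear_growth_window _ y (k + m) j (fun i _ => grow i).
    move=> /le_trans; apply; rewrite ler_wpM2r ?(ltW (y0 _))// ler_nat.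
    by have := ltn_ord j; lia.
  have H2 : Y k.+1 <= Y (k + m)%N.
    by have -> : (k + m = k.+1 + m.-1)%N by lia.
  have kmm : 0 < (k + m + m)%:R :> R by rewrite ltr0n; lia.
  rewrite -(ler_pM2l kmm) [leRHS]mulrCA.
  apply: (@le_trans _ _ (k%:R * ((k + m).+1%:R * Y k.+1))); last first.
    rewrite ler_wpM2l ?ler0n//; apply: le_trans H1.
    by rewrite ler_wpM2l ?ler0n.
  rewrite !mulrA ler_wpM2r ?(ltW (Y0 _))// -natr1 !natrD.
  have : 0 <= k%:R :> R by rewrite ler0n.
  have : 0 <= m%:R * m%:R :> R by rewrite mulr_ge0 ?ler0n.
  nra.
pose F k := G k / Y k.
have F0 k : 0 <= F k by rewrite divr_ge0 ?(ltW (Y0 k)).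
have kF k : k%:R * F k <= 1 by rewrite mulrA ler_pdivrMr ?Y0// mul1r.
(* Division by [Y k.+1 = (1 + F k) * Y k], with [f / (1 + f) <= f - f^2 + f^3]. *)
have FS k : (0 < k)%N -> F k.+1 <= F k - F k ^+ 2 + F k ^+ 3 -
    theta ^+ 2 * logq kappa N.+1 (u (k + m)%N) * (1 - m%:R / k%:R).
  move=> kpos; have kR : 0 < k%:R :> R by rewrite ltr0n.
  rewrite {1}/F ler_pdivrMr ?Y0// mulrBl.
  apply: (le_trans (GS k)); apply: lerB.
    have -> : G k = F k * Y k by rewrite /F divfK ?gt_eqF.
    have -> : Y k.+1 = (1 + F k) * Y k by rewrite YS mulrDl mul1r /F divfK ?gt_eqF.
    rewrite mulrA ler_wpM2r ?(ltW (Y0 _))//.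
    have : 0 <= F k ^+ 4 by rewrite exprn_ge0.
    lra.
  rewrite -[leLHS]mulrA (ler_wpM2l (mulr_ge0 (sqr_ge0 _) (q0 _)))//.
  rewrite -(ler_pM2l kR) mulrA mulrBr mulr1 mulrCA divff ?gt_eqF// mulr1.
  exact: My.
have step k : u k.+1 - u k <= theta + k.+1%:R^-1.
  rewrite hu -addrA lerD2l; apply: (le_trans (ln_sub_le _ _ _ (y0 _) (y0 _))).
  rewrite ler_pdivrMr// mulrC ler_pdivlMr ?ltr0n//.
  by have := grow k; rewrite -[k.+2%:R]natr1; lra.
have ub k : u k <= u 0%N + (theta + 1) * k%:R.
  elim: k => [|k IH]; first by rewrite mulr0 addr0.
  have := step k; have : k.+1%:R^-1 <= 1 :> R by rewrite invf_le1 ?ltr0n ?ler1n.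
  rewrite -natr1; lra.
have [B B0 BP] := logq_le_sqr _ _ N (ltW k0).
(* By [ub], [u] grows at most linearly, so [1 / k <= L / s] eventually: errors in [k] become errors
   in [s]. The factor 2 absorbs the offsets. *)
pose L := 2 * (theta + 1).
have L0 : 0 < L by rewrite mulr_gt0// ltr_pwDl.
pose A := (L ^+ 3 / theta + L ^+ 3 / theta ^+ 2 + L * B + theta * m%:R * L * B) / theta.
have gap := logq_gap _ _ _ N.+1 A (midf_lt k0).2.
have k20 : 0 < (0 + kappa) / 2 by rewrite add0r divr_gt0.
have soo : forall A, \forall k \near \oo, A <= u (k + m)%N.
  move=> A'; have [K _ KP] := uoo A'; exists K => // k /= Kk.
  by apply: KP => /=; rewrite (leq_trans Kk) ?leq_addr.
have near_s (P : R -> Prop) :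
    (\forall s \near +oo, P s) -> \forall k \near \oo, P (u (k + m)%N).
  move=> [C [_ CP]]; have := soo (C + 1).
  by apply: filterS => k Ck; apply: CP; apply: lt_le_trans Ck; rewrite ltrDl.
(* The Riccati inequality drives [F] to minus infinity, against [F0]. *)
suff : forall A, \forall k \near \oo, F k / theta <= A.
  move=> /(_ (-1)) [K _ /(_ K (leqnn _))].
  have : 0 <= F K / theta by rewrite divr_ge0 ?(ltW th0).
  lra.
apply: (@riccati_ninfty _ ((0 + kappa) / 2) N.+1 (fun k => u (k + m)%N)) => //.
  by near=> k; rewrite addSn.
near=> k.
have kpos : (0 < k)%N by near: k; apply: nbhs_infty_gt.
have kR : 0 < k%:R :> R by rewrite ltr0n.
have s1 : 1 <= u (k + m)%N by near: k; apply: soo.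
have s0 : 0 < u (k + m)%N by apply: lt_le_trans s1.
have sL : u (k + m)%N <= L * k%:R.
  apply: (le_trans (ub _)).
  have : (u 0%N + (theta + 1) * m%:R) / (theta + 1) <= k%:R.
    by near: k; apply: nbhs_infty_ger.
  by rewrite ler_pdivrMr ?ltr_pwDl// natrD /L; lra.
have hk : k%:R^-1 <= L / u (k + m)%N.
  by rewrite ler_pdivlMr// mulrC ler_pdivrMr.
have hgap : A / u (k + m)%N ^+ 3 <=
    logq kappa N.+1 (u (k + m)%N) - logq ((0 + kappa) / 2) N.+1 (u (k + m)%N).
  by near: k; apply: (near_s _ gap).
have hB : logq kappa N.+1 (u (k + m)%N) <= B / u (k + m)%N ^+ 2.
  by near: k; apply: (near_s _ BP).
have dk : u (k + m).+1 - u (k + m)%N <= theta + k%:R^-1.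
  apply: (le_trans (step _)); rewrite lerD2l lef_pV2 ?posrE ?ltr0n// ler_nat.
  by rewrite leqW ?leq_addr.
have d0 : 0 <= u (k + m).+1 - u (k + m)%N by rewrite subr_ge0.
have Fk : F k <= k%:R^-1 by rewrite -(ler_pM2l kR) divff ?gt_eqF.
have hA : 0 <= A / u (k + m)%N ^+ 3.
  apply: divr_ge0; last by rewrite exprn_ge0// ltW.
  have tL := mulr_ge0 (ltW L0) (ltW B0).
  have L3 : 0 <= L ^+ 3 by rewrite exprn_ge0// ltW.
  apply: divr_ge0 (ltW th0); apply: addr_ge0.
    by apply: addr_ge0 tL; rewrite addr_ge0// divr_ge0// ?sqr_ge0// ltW.
  by have := mulr_ge0 (mulr_ge0 (ltW th0) (ltW mR)) tL; rewrite !mulrA.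
rewrite addSn; apply: (le_trans (ler_wpM2r _ (FS k kpos))).
  by rewrite invr_ge0 ltW.
apply: (@riccati_error _ theta m%:R L B A _ k%:R^-1 _ _ (u (k + m)%N)) => //.
- by rewrite F0.
- by rewrite logq_ge0 ?(ltW k20)//= -subr_ge0 (le_trans hA).
- by rewrite /A divfK// gt_eqF.
Unshelve. all: by end_near. Qed.

(** * Near-equality in AM-GM and the cyclic order *)

Lemma expR_quadratic (R : realType) (x : R) : -2 <= x ->
  1 + x + x ^+ 2 / 4 <= expR x.
Proof.
move=> x2; have -> : expR x = expR (x / 2) ^+ 2.
  by rewrite -expRM_natr; congr expR; field.
have -> : 1 + x + x ^+ 2 / 4 = (1 + x / 2) ^+ 2 by field.
by rewrite lerXn2r ?nnegrE ?expR_ge0 ?expR_ge1Dx//; lra.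
Qed.

(** Stability of [1 + x <= expR x]. Below -2 the excess is larger than 1, hence the minimum with
    1. *)
Lemma expR_excess_small (R : realType) (e : R) : 0 < e ->
  exists2 eta, 0 < eta & forall x, expR x - 1 - x < eta -> `|x| < e.
Proof.
move=> e0; exists (Num.min 1 (e ^+ 2 / 4)).
  by rewrite lt_min ltr01 divr_gt0// exprn_gt0.
move=> x; rewrite lt_min => /andP[h1 h2].
case: (lerP (-2) x) => x2; last by have := expR_gt0 x; lra.
have := expR_quadratic _ _ x2 => h3.
rewrite -(@ltr_pXn2r _ 2) ?nnegrE ?normr_ge0 ?(ltW e0)// real_normK ?num_real//.
lra.
Qed.

Lemma noninc_steps_small (R : realType) (V : nat -> R) :
  (forall k, 0 <= V k) -> (forall k, V k.+1 <= V k) ->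
  forall e, 0 < e -> \forall k \near \oo, V k - V k.+1 < e.
Proof.
move=> V0 VS e e0.
have cV : cvgn V.
  apply: nonincreasing_is_cvgn.
    by apply/nonincreasing_seqP.
  by exists 0 => _ [k _ <-].
have e20 : 0 < e / 2 by rewrite divr_gt0.
move/cvgrPdist_lt: cV => /(_ _ e20)[K _ KP].
exists K => // k Kk.
have := KP k Kk; have := KP k.+1 (leqW Kk); rewrite !ltr_norml.
by move=> /andP[h1 h2] /andP[h3 h4]; lra.
Qed.

(* AM-GM makes sum_i ln (t k / P k i) nonincreasing in k whatever coordinate is
   used; its convergence forces asymptotic equality in AM-GM, hence
   t k.+1 / t k -> gamma and P k (idx k) / t k -> gamma^-m, so that the entry used
   is eventually the oldest one. *)
Lemma eventually_cyclic (R : realType) (m : nat) (gamma p0 : R) (t : nat -> R)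
    (idx : nat -> 'I_m.+1) (P : nat -> 'I_m.+1 -> R) :
  (0 < m)%N -> 1 < gamma -> gamma ^+ m.+1 = m%:R ->
  0 < p0 -> p0 <= t 0%N -> (forall k, t k <= t k.+1) ->
  (forall i, P 0%N i = p0) ->
  (forall k i, P k.+1 i = if i == idx k then t k.+1 else P k i) ->
  (forall k, t k.+1 + P k (idx k) <= m.+1%:R * gamma / m%:R * t k) ->
  (forall e, 0 < e -> \forall k \near \oo,
     `|ln (t k.+1) - ln (t k) - ln gamma| < e) /\
  (\forall k \near \oo, P (k + m)%N (idx (k + m)%N) = t k).
Proof.
move=> m0 g1 gm p00 p0t tS PO PS rec.
have mR : 0 < m%:R :> R by rewrite ltr0n.
have g0 : 0 < gamma by apply: lt_trans g1.
have th0 : 0 < ln gamma by apply: ln_gt0.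
have t0 k : 0 < t k.
  by elim: k => [|k IH]; [apply: lt_le_trans p0t | apply: lt_le_trans (tS k)].
have tmono j k : (j <= k)%N -> t j <= t k.
  move=> /subnKC <-; elim: (k - j)%N => [|n IH]; first by rewrite addn0.
  by rewrite addnS (le_trans IH).
have Pt k i : P k i <= t k.
  elim: k => [|k IH]; first by rewrite PO.
  by rewrite PS; case: ifP => // _; apply: le_trans (tS k).
have P0 k i : 0 < P k i.
  by elim: k => [|k IH]; rewrite ?PO// PS; case: ifP.
have Pex k i : P k i = p0 \/ exists2 j, (j <= k)%N & P k i = t j.
  elim: k => [|k [IH|[j jk IH]]]; first by left.
    by rewrite PS; case: ifP => _; [right; exists k.+1|left].
  by rewrite PS; case: ifP => _; right; [exists k.+1|exists j => //; rewrite leqW].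
pose u k := ln (t k).
(* [a] and [b] are the logarithms of [t k.+1 / t k] and [P k (idx k) / t k], normalized by their
   expected limits [gamma] and [gamma^-m]. *)
pose a k := u k.+1 - u k - ln gamma.
pose b k := ln (P k (idx k)) - u k + m%:R * ln gamma.
pose V k := \sum_i (u k - ln (P k i)).
have V0 k : 0 <= V k.
  by apply: sumr_ge0 => i _; rewrite subr_ge0 ler_lnM.
have VS k : V k.+1 - V k = m%:R * a k + b k.
  rewrite /V -sumrB.
  have -> : \sum_i (u k.+1 - ln (P k.+1 i) - (u k - ln (P k i))) =
     \sum_(i < m.+1) (u k.+1 - u k) - \sum_i (ln (P k.+1 i) - ln (P k i)).
    by rewrite -sumrB; apply: eq_bigr => i _; ring.
  rewrite sumr_const card_ord -[_ *+ m.+1]mulr_natl.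
  rewrite [X in _ - X](bigD1 (idx k))//= PS eqxx big1 ?addr0; last first.
    by move=> i /negbTE ik; rewrite PS ik subrr.
  by rewrite /a /b /u -natr1; ring.
(* This is [rec] divided by [t k]. With [1 + x <= expR x] it gives [m a + b <= 0], so [V] is
   nonincreasing. *)
have amgm k : m%:R * expR (a k) + expR (b k) <= m.+1%:R.
  have -> : expR (a k) = t k.+1 / t k / gamma.
    by rewrite /a /u !expRB !lnK ?posrE.
  have -> : expR (b k) = P k (idx k) / t k * (m%:R / gamma).
    rewrite /b /u expRD expRB mulr_natl -lnXn// !lnK ?posrE ?exprn_gt0//.
    by rewrite -gm exprS [gamma * _ / _]mulrAC divff ?gt_eqF// mul1r.
  have := rec k; rewrite -ler_pdivrMr// => h.
  have -> : m%:R * (t k.+1 / t k / gamma) + P k (idx k) / t k * (m%:R / gamma) =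
     (t k.+1 + P k (idx k)) / t k * (m%:R / gamma).
    by field; rewrite !gt_eqF.
  apply: (le_trans (ler_wpM2r _ h)); first by rewrite divr_ge0 ?(ltW mR) ?(ltW g0).
  rewrite le_eqVlt; apply/orP; left; apply/eqP.
  by field; rewrite !gt_eqF.
have ha k : 0 <= expR (a k) - 1 - a k by have := expR_ge1Dx (a k); lra.
have hb k : 0 <= expR (b k) - 1 - b k by have := expR_ge1Dx (b k); lra.
have loss k : (expR (a k) - 1 - a k) + (expR (b k) - 1 - b k) <= V k - V k.+1.
  have m1 : 1 <= m%:R :> R by rewrite ler1n.
  have := VS k; have := amgm k; rewrite -natr1.
  have := ler_wpM2r (ha k) m1; rewrite mul1r; lra.
have Vnon k : V k.+1 <= V k.
  by have := loss k; have := ha k; have := hb k; lra.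
have small e : 0 < e -> \forall k \near \oo, `|a k| < e /\ `|b k| < e.
  move=> e0; have [eta eta0 etaP] := expR_excess_small _ _ e0.
  have := noninc_steps_small _ _ V0 Vnon _ eta0.
  apply: filterS => k Vk; have := loss k; have := ha k; have := hb k.
  by move=> *; split; apply: etaP; lra.
split; first by move=> e e0; apply: filterS (small e e0) => k [].
(* With this tolerance an entry of age at least [m.+1] is too old for [b], and one of age at most
   [m.-1] too young; only age [m] remains. *)
pose eta := ln gamma / (m.+2)%:R.
have eta0 : 0 < eta by rewrite divr_gt0// ltr0n.
have etaE : ln gamma = m.+2%:R * eta by rewrite mulrC divfK// gt_eqF// ltr0n.
have [K _ KP] := small _ eta0.
have drift j n : (K <= j)%N ->
    n%:R * (ln gamma - eta) <= u (j + n)%N - u j <= n%:R * (ln gamma + eta).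
  move=> Kj; elim: n => [|n /andP[IH1 IH2]]; first by rewrite addn0 subrr !mul0r lexx.
  have [] := KP (j + n)%N (leq_trans Kj (leq_addr _ _)).
  rewrite /a ltr_norml => /andP[h1 h2] _; rewrite addnS -natr1.
  by apply/andP; split; lra.
exists (K + m.+1)%N => // k /= Kk.
have Kkm : (K <= k + m)%N.
  by apply: leq_trans (leq_addr _ _); apply: leq_trans Kk; apply: leq_addr.
have [_] := KP _ Kkm; rewrite /b ltr_norml => /andP[b1 b2].
set pk := P _ _ in b1 b2 *.
(* The entry in use is more recent than [K]: it is not an initial value, and [drift] reaches back to
   its creation. *)
have old : t K < pk.
  have uKk : m.+1%:R * (ln gamma - eta) <= u (k + m)%N - u K.
    have := drift K (k + m - K)%N (leqnn _); rewrite subnKC// => /andP[h _].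
    apply: le_trans h; rewrite ler_wpM2r//.
      by rewrite etaE -!natr1; have := mulr_gt0 mR eta0; lra.
    rewrite ler_nat leq_subRL//; apply: leq_trans (leq_addr _ _).
    exact: Kk.
  have h : u K < ln pk.
    move: uKk b1; rewrite -[m.+1%:R]natr1; have := mulr_gt0 mR eta0.
    rewrite etaE -!natr1; lra.
  by move: h; rewrite /u ltr_ln ?posrE ?t0 ?P0.
have [E|[j jk E]] := Pex (k + m)%N (idx (k + m)%N).
  move: old; rewrite /pk E => /lt_le_trans/(_ p0t).
  by rewrite ltNge tmono.
have Kj : (K <= j)%N.
  move: old; rewrite /pk E leqNgt => tKj; apply/negP => /ltnW/tmono.
  by rewrite leNgt tKj.
rewrite /pk E; congr t.
have := drift j (k + m - j)%N Kj; rewrite subnKC//.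
move: b1 b2; rewrite /pk E -/(u j); set n := (k + m - j)%N => b1 b2 /andP[d1 d2].
have : (n < m.+1)%N.
  rewrite ltnNge -(@ler_nat R); apply/negP => mn.
  have : m.+1%:R * (ln gamma - eta) <= n%:R * (ln gamma - eta).
    by rewrite ler_wpM2r// etaE -!natr1; have := mulr_gt0 mR eta0; lra.
  have := mulr_gt0 mR eta0.
  rewrite -[m.+1%:R]natr1; move: d1 b1; rewrite etaE -!natr1; lra.
have : (m.-1 < n)%N.
  rewrite ltnNge -(@ler_nat R); apply/negP => mn.
  have : n%:R * (ln gamma + eta) <= m.-1%:R * (ln gamma + eta).
    by rewrite ler_wpM2r// addr_ge0 ?ltW.
  have -> : m.-1%:R = m%:R - 1 :> R by rewrite -[in RHS](prednK m0) -natr1 addrK.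
  have := mulr_gt0 mR eta0.
  move: d2 b2; rewrite etaE -!natr1; lra.
clear -jk m0; rewrite /n; lia.
Qed.

(** The factor [m.+1 * gamma / m] is [omega], so this is [- ln psi] at [t = ln q]. *)
Definition critical_exp (R : realType) (m : nat) (gamma kappa : R) (N : nat)
    (t : R) : R :=
  m.+1%:R * gamma / m%:R * t *
    (1 - m%:R * ln gamma ^+ 2 / 2 * logq kappa N (ln t)).
Arguments critical_exp {R}.

Lemma no_bad_sequence (R : realType) (m N : nat) (gamma kappa p0 : R)
    (t : nat -> R) (idx : nat -> 'I_m.+1) (P : nat -> 'I_m.+1 -> R) :
  (0 < m)%N -> 1 < gamma -> gamma ^+ m.+1 = m%:R -> 0 < kappa ->
  0 < p0 -> p0 <= t 0%N -> (forall k, t k <= t k.+1) ->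
  (forall A, \forall k \near \oo, A <= t k) ->
  (forall i, P 0%N i = p0) ->
  (forall k i, P k.+1 i = if i == idx k then t k.+1 else P k i) ->
  (forall k, t k.+1 + P k (idx k) <= critical_exp m gamma kappa N.+1 (t k)) ->
  False.
Proof.
move=> m0 g1 gm k0 p00 p0t tS too PO PS rec.
have mR : 0 < m%:R :> R by rewrite ltr0n.
have g0 : 0 < gamma by apply: lt_trans g1.
have th0 : 0 < ln gamma by apply: ln_gt0.
have t0 k : 0 < t k.
  by elim: k => [|k IH]; [apply: lt_le_trans p0t | apply: lt_le_trans (tS k)].
have rec0 k : t k.+1 + P k (idx k) <= m.+1%:R * gamma / m%:R * t k.
  apply: (le_trans (rec k)); rewrite /critical_exp ler_piMr//.
    by rewrite mulr_ge0 ?(ltW (t0 k))// divr_ge0 ?mulr_ge0 ?ler0n// ltW.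
  rewrite gerBl mulr_ge0 ?logq_ge0 ?(ltW k0)//.
  by rewrite divr_ge0// mulr_ge0 ?sqr_ge0// ltW.
have [ratio [K1 _ cyc]] := eventually_cyclic _ _ _ _ _ _ _ m0 g1 gm p00 p0t tS PO PS rec0.
(* The tolerance [ln (1 + 1/m)] yields [y n.+1 <= (1 + 1/m) * y n], which starts [linear_growth]. *)
have m1 : 1 < 1 + m%:R^-1 :> R by rewrite ltrDl invr_gt0.
have [K2 _ rat] := ratio _ (ln_gt0 m1).
pose K := maxn K1 K2.
pose g (n : nat) : R := gamma ^+ n.
have gn0 n : 0 < g n by rewrite exprn_gt0.
pose y n := t (K + n)%N / g n.
pose u n := ln (t (K + n)%N).
have y0 n : 0 < y n by rewrite divr_gt0.
have lny n : ln (y n) = u n - n%:R * ln gamma.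
  by rewrite /y ln_div ?posrE// lnXn// mulr_natl.
have yrec n : m%:R * y (n + m).+1 + y n <= m.+1%:R * y (n + m)%N *
     (1 - m%:R * ln gamma ^+ 2 / 2 * logq kappa N.+1 (u (n + m)%N)).
  have := rec (K + (n + m))%N.
  have -> : P (K + (n + m))%N (idx (K + (n + m))%N) = t (K + n)%N.
    by rewrite addnA cyc//= (leq_trans (leq_maxl K1 K2)) ?leq_addr.
  rewrite /critical_exp -/(u _) /y addnS.
  move: (1 - _) (t (K + (n + m)).+1) (t (K + n)%N) (t (K + (n + m))%N) => c t1 t2 t3 h.
  have cc : 0 <= m%:R / g (n + m).+1 by rewrite divr_ge0 ?(ltW (gn0 _)) ?ler0n.
  have := ler_wpM2l cc h.
  (* [gamma ^+ m.+1 = m] turns the delayed term into [y n] with coefficient 1. *)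
  have gE : g (n + m).+1 = g n * m%:R by rewrite /g -addnS exprD gm.
  have gE' : g (n + m).+1 = gamma * g (n + m)%N by rewrite /g exprS.
  have -> : m%:R / g (n + m).+1 * (t1 + t2) = m%:R * (t1 / g (n + m).+1) + t2 / g n.
    by rewrite gE; field; rewrite !gt_eqF.
  have -> // : m%:R / g (n + m).+1 * (m.+1%:R * gamma / m%:R * t3 * c) =
    m.+1%:R * (t3 / g (n + m)%N) * c.
  by rewrite gE'; field; rewrite !gt_eqF.
have q0 n : 0 <= m%:R * ln gamma ^+ 2 / 2 * logq kappa N.+1 (u n).
  by rewrite mulr_ge0 ?logq_ge0 ?(ltW k0)// divr_ge0// mulr_ge0 ?sqr_ge0// ltW.
have ySle n : m%:R * y n.+1 <= m.+1%:R * y n.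
  have := rat (K + n)%N; rewrite /= (leq_trans (leq_maxr K1 K2)) ?leq_addr//.
  move=> /(_ isT); rewrite ltr_norml => /andP[_ h].
  have p1 := lt_trans ltr01 m1.
  have yp := mulr_gt0 (y0 n) p1.
  have : ln (y n.+1) < ln (y n * (1 + m%:R^-1)).
    rewrite lnM ?posrE// !lny -natr1 /u addnS; lra.
  rewrite ltr_ln ?posrE// => /ltW.
  rewrite -(ler_pM2l mR) => /le_trans; apply.
  rewrite mulrCA mulrDr mulr1 divff ?gt_eqF// natr1 mulrC//.
apply: (@delay_oscillation R kappa (ln gamma) N m y u) => //.
- by move=> n; rewrite !lny -natr1; ring.
- by move=> n; rewrite /u addnS ler_lnM.
- move=> A; have [K3 _ KP] := too (expR A); exists K3 => // n /= Kn.
  by apply: ge_expR_ln; apply: KP => /=; rewrite (leq_trans Kn)// leq_addl.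
- apply: (@linear_growth R m y) => // n; apply: (le_trans (yrec n)).
  apply: ler_piMr; last by rewrite gerBl.
  exact: mulr_ge0 (ler0n _ _) (ltW (y0 _)).
Qed.

(** The gain exceeds any multiple of [t / (ln t)^3], so a smaller [kappa] absorbs every additive
    constant, that is, every constant factor of psi. *)
Lemma critical_exp_gap (R : realType) (m N : nat) (gamma kappa kappa' K : R) :
  (0 < m)%N -> 1 < gamma -> kappa' < kappa ->
  \forall t \near +oo,
    critical_exp m gamma kappa N t + K <= critical_exp m gamma kappa' N t.
Proof.
move=> m0 g1 kk.
have mR : 0 < m%:R :> R by rewrite ltr0n.
have g0 : 0 < gamma by apply: lt_trans g1.
have th0 : 0 < ln gamma by apply: ln_gt0.
pose c := m.+1%:R * gamma / m%:R * (m%:R * ln gamma ^+ 2 / 2).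
have c0 : 0 < c.
  by rewrite mulr_gt0// divr_gt0// mulr_gt0 ?ltr0n// exprn_gt0.
near=> t.
have t0 : 0 < t by near: t; apply: (nbhs_pinfty_gt (num_real _)).
have gap : 1 / ln t ^+ 3 <= logq kappa N (ln t) - logq kappa' N (ln t).
  by near: t; apply: (near_pinfty_ln _ _ (logq_gap _ _ _ N 1 kk)).
have l0 : 1 <= ln t by near: t; apply: near_pinfty_ln_ge.
have cub : `|K| / c * ln t ^+ 3 <= t by near: t; apply: near_ln_cube.
have l3 : 0 < ln t ^+ 3 by rewrite exprn_gt0// (lt_le_trans ltr01).
have h : `|K| <= c * t * (1 / ln t ^+ 3).
  by rewrite mul1r ler_pdivlMr// -ler_pdivrMl// mulrC mulrAC.
have h2 : c * t * (1 / ln t ^+ 3) <= c * t * (logq kappa N (ln t) - logq kappa' N (ln t)).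
  by rewrite ler_wpM2l// mulr_ge0 ?ltW.
have h3 := le_trans h h2.
have h4 := ler_norm K.
rewrite -subr_ge0 /critical_exp.
have := le_trans h4 h3; rewrite /c; lra.
Unshelve. all: by end_near. Qed.

Lemma critical_factor_ge0 (R : realType) (m N : nat) (gamma kappa : R) :
  (0 < m)%N -> 1 < gamma -> 0 <= kappa ->
  \forall s \near +oo, 0 <= 1 - m%:R * ln gamma ^+ 2 / 2 * logq kappa N.+1 s.
Proof.
move=> m0 g1 k0.
have mR : 0 < m%:R :> R by rewrite ltr0n.
have th0 : 0 < ln gamma by apply: ln_gt0.
have c0 : 0 < m%:R * ln gamma ^+ 2 / 2.
  by rewrite divr_gt0// mulr_gt0// exprn_gt0.
have ci0 : 0 < (m%:R * ln gamma ^+ 2 / 2)^-1 by rewrite invr_gt0.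
apply: filterS (logq_le _ _ N _ k0 ci0) => s.
by rewrite -(ler_pM2l c0) divff ?gt_eqF// subr_ge0.
Qed.

(** Serves to pass from the height of an approximation to a larger bound [Q] on its denominators. *)
Lemma critical_exp_mono (R : realType) (m N : nat) (gamma kappa : R) :
  (0 < m)%N -> 1 < gamma -> 0 <= kappa ->
  \forall t \near +oo, forall t', t <= t' ->
    critical_exp m gamma kappa N.+1 t <= critical_exp m gamma kappa N.+1 t'.
Proof.
move=> m0 g1 k0.
have mR : 0 < m%:R :> R by rewrite ltr0n.
have g0 : 0 < gamma by apply: lt_trans g1.
have th0 : 0 < ln gamma by apply: ln_gt0.
have w0 : 0 < m.+1%:R * gamma / m%:R by rewrite divr_gt0// mulr_gt0 ?ltr0n.
near=> t => t' tt'.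
have t0 : 0 < t by near: t; apply: (nbhs_pinfty_gt (num_real _)).
apply: ler_pM.
- by rewrite mulr_ge0 ?(ltW w0) ?(ltW t0).
- near: t; apply: (near_pinfty_ln _ _ (critical_factor_ge0 _ _ N _ _ m0 g1 k0)).
- by rewrite ler_wpM2l ?(ltW w0).
- rewrite lerD2l lerN2 ler_wpM2l//.
    by rewrite divr_ge0// mulr_ge0 ?sqr_ge0// ltW.
  have := ler_lnM _ _ _ t0 tt'; move: (ln t').
  by near: t; apply: (near_pinfty_ln _ _ (logq_noninc _ _ N.+1 k0)).
Unshelve. all: by end_near. Qed.

(** * Best approximations of a real number *)

Lemma denq_frac_le (p : int) (q : nat) : (0 < q)%N ->
  (`|denq (p%:~R / q%:R)| <= q)%N.
Proof.
move=> q0; set r := _ / _.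
have q0' : q%:R != 0 :> rat by rewrite pnatr_eq0 -lt0n.
have d0 : (denq r)%:~R != 0 :> rat by rewrite intr_eq0 denq_neq0.
have E : numq r * q%:Z = p * denq r.
  apply: (@intr_inj rat); rewrite !intrM -[q%:Z%:~R]pmulrn.
  rewrite -[(numq r)%:~R](divfK d0) (divq_num_den r) {1}/r.
  by rewrite mulrAC divfK.
apply: dvdn_leq => //.
rewrite -(@Gauss_dvdr _ `|numq r|%N); last by rewrite coprime_sym coprime_num_den.
have -> : (`|numq r| * q = `|p| * `|denq r|)%N.
  by rewrite -abszM -E abszM absz_nat.
exact: dvdn_mull.
Qed.

Definition dist_int (R : realType) (y : R) : R :=
  Num.min (y - (Num.floor y)%:~R) ((Num.floor y + 1)%:~R - y).
Arguments dist_int {R}.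

Lemma dist_int_le (R : realType) (y : R) (p : int) : dist_int y <= `|y - p%:~R|.
Proof.
have /andP[f1 f2] := floor_itv y.
rewrite /dist_int ge_min; case: (lerP p (Num.floor y)) => pf.
  apply/orP; left; apply: le_trans (ler_norm _).
  by rewrite lerD2l lerN2 ler_int.
apply/orP; right; rewrite distrC; apply: le_trans (ler_norm _).
by rewrite lerD2r ler_int lezD1.
Qed.

Lemma dist_int_ex (R : realType) (y : R) : exists p : int, `|y - p%:~R| = dist_int y.
Proof.
have /andP[f1 f2] := floor_itv y.
rewrite /dist_int; case: (lerP (y - (Num.floor y)%:~R) ((Num.floor y + 1)%:~R - y)) => h.
  by exists (Num.floor y); rewrite ger0_norm// subr_ge0.
by exists (Num.floor y + 1); rewrite distrC ger0_norm// subr_ge0 ltW.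
Qed.

Lemma dirichlet_approx (R : realType) (x : R) (N : nat) : (0 < N)%N ->
  exists2 q : nat, (0 < q <= N)%N & dist_int (q%:R * x) < N%:R^-1.
Proof.
move=> N0; have NR : 0 < N%:R :> R by rewrite ltr0n.
pose fr (k : nat) : R := k%:R * x - (Num.floor (k%:R * x))%:~R.
have fr01 k : 0 <= fr k < 1.
  have /andP[f1 f2] := floor_itv (k%:R * x); rewrite /fr.
  by move: f2; rewrite intrD; lra.
pose f (k : 'I_N.+1) : 'I_N := insubd (Ordinal N0) `|Num.floor (N%:R * fr k)|%N.
have fE k : (f k : nat)%:Z = Num.floor (N%:R * fr k).
  have /andP[h1 h2] := fr01 k.
  have g0 : 0 <= Num.floor (N%:R * fr k) by rewrite floor_ge0 mulr_ge0 ?ler0n.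
  have gN : (`|Num.floor (N%:R * fr k)| < N)%N.
    rewrite -ltz_nat gez0_abs// floor_lt_int -pmulrn.
    by rewrite -[ltRHS]mulr1 ltr_pM2l.
  by rewrite /f val_insubd gN gez0_abs.
have : ~~ injectiveb f.
  apply/negP => /injectiveP /leq_card; rewrite !card_ord; lia.
case/injectivePn => i [j ij fij].
wlog lij : i j ij fij / (i < j)%N.
  move=> W; have [|ji|/val_inj E] := ltngtP i j; first exact: W.
    by apply: (W j i) => //; rewrite eq_sym.
  by rewrite E eqxx in ij.
exists (j - i)%N; first by rewrite subn_gt0 lij leq_subLR; have := ltn_ord j; lia.
apply: (le_lt_trans (dist_int_le _ _ (Num.floor (j%:R * x) - Num.floor (i%:R * x)))).
have -> : (j - i)%:R * x - (Num.floor (j%:R * x) - Num.floor (i%:R * x))%:~R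
    = fr j - fr i.
  by rewrite natrB ?(ltnW lij)// /fr intrB; ring.
have E : Num.floor (N%:R * fr i) = Num.floor (N%:R * fr j) by rewrite -!fE fij.
have /andP[a1 a2] := floor_itv (N%:R * fr i).
have /andP[b1 b2] := floor_itv (N%:R * fr j).
rewrite intrD in b1 b2; rewrite E intrD in a1 a2.
rewrite -(ltr_pM2l NR) divff ?gt_eqF// -{1}[N%:R]gtr0_norm// -normrM mulrBr ltr_norml.
apply/andP; split; lra.
Qed.

(* pr Q and nx Q are the last denominator <= Q and the first one > Q that improve
   on all smaller denominators. For rational x, where these stop, every
   denominator is allowed and the approximation is x itself. *)
Lemma approx_denominators (R : realType) (x : R) :
  exists (pr nx : nat -> nat) (Q0 : nat), forall Q, (Q0 <= Q)%N ->
  [/\ (2 <= pr Q <= Q)%N, (Q < nx Q)%N, pr (nx Q) = nx Q,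
      forall Q', (Q <= Q')%N -> (pr Q <= pr Q')%N &
      exists2 r : rat, (`|denq r| <= Q)%N &
        `|x - ratr r| <= 2 / ((pr Q)%:R * (nx Q)%:R)].
Proof.
have [[r _ rx]|irr] := pselect (range (@ratr R) x).
  exists id, S, (maxn 2 `|denq r|) => Q; rewrite geq_max => /andP[Q2 Qr].
  split=> //; first by rewrite Q2 leqnn.
  by exists r => //; rewrite rx subrr normr0 divr_ge0// mulr_ge0 ?ler0n.
pose nu (q : nat) := dist_int (q%:R * x).
have nu0 q : (0 < q)%N -> 0 < nu q.
  move=> q0; have [p pE] := dist_int_ex _ (q%:R * x).
  rewrite /nu -pE normr_gt0; apply/eqP => E; apply: irr.
  exists (p%:~R / q%:R) => //; rewrite fmorph_div/= ratr_int ratr_nat.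
  have -> : p%:~R = q%:R * x by apply/esym/eqP; rewrite -subr_eq0 E.
  by rewrite mulrAC divff ?mul1r// pnatr_eq0 -lt0n.
pose record q := (0 < q)%N && [forall j : 'I_q, (0 < j)%N ==> (nu q < nu j)].
have recP q : reflect ((0 < q)%N /\ forall j, (0 < j < q)%N -> nu q < nu j) (record q).
  apply: (iffP andP) => -[q0 H]; split=> //.
    by move=> j /andP[j0 jq]; have /forallP/(_ (Ordinal jq))/implyP/(_ j0) := H.
  by apply/forallP => j; apply/implyP => j0; apply: H; rewrite j0/=.
have rec1 : record 1%N by apply/recP; split=> // j; lia.
have recgt Q : exists n, record n && (Q < n)%N.
  have [e e0 eP] : exists2 e, 0 < e & forall q, (0 < q <= Q)%N -> e <= nu q.
    elim: Q => [|Q [e e0 eP]]; first by exists 1 => // q; lia.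
    exists (Num.min e (nu Q.+1)); first by rewrite lt_min e0 nu0.
    move=> q /andP[q0]; rewrite leq_eqVlt => /orP[/eqP->|qQ].
      by rewrite ge_min lexx orbT.
    by rewrite ge_min eP// q0.
  have [q /andP[q0 _] qe] := dirichlet_approx _ x (Num.bound e^-1).+1 (ltn0Sn _).
  have ex : exists n, (0 < n)%N && (nu n < e).
    exists q; rewrite q0 (lt_trans qe)// invf_plt ?posrE// ?ltr0n//.
    apply: (lt_trans (archi_boundP _)); rewrite ?invr_ge0 ?(ltW e0)// ltr_nat//.
  case: (ex_minnP ex) => n /andP[n0 ne] nmin.
  exists n; apply/andP; split.
    apply/recP; split=> // j /andP[j0 jn]; apply: (lt_le_trans ne).
    rewrite leNgt; apply/negP => je; have := nmin j; rewrite j0 je => /(_ isT).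
    by rewrite leqNgt jn.
  rewrite ltnNge; apply/negP => nQ.
  by have := eP n; rewrite n0 nQ leNgt ne => /(_ isT).
have [pr prP] : {pr : nat -> nat & forall Q, (0 < Q)%N ->
    [/\ record (pr Q), (pr Q <= Q)%N &
    forall n, record n -> (n <= Q)%N -> (n <= pr Q)%N]}.
  apply: (@choice _ _ (fun Q q => (0 < Q)%N -> [/\ record q, (q <= Q)%N &
    forall n, record n -> (n <= Q)%N -> (n <= q)%N])) => Q.
  have [->|Q0] := posnP Q; first by exists 0%N.
  have ex : exists n, record n && (n <= Q)%N by exists 1%N; rewrite rec1.
  have ub n : record n && (n <= Q)%N -> (n <= Q)%N by case/andP.
  case: (ex_maxnP ex ub) => n /andP[n1 n2] nmax; exists n => _; split=> // l l1 l2.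
  by apply: nmax; rewrite l1.
have [nx nxP] : {nx : nat -> nat & forall Q, [/\ record (nx Q), (Q < nx Q)%N &
    forall n, record n -> (Q < n)%N -> (nx Q <= n)%N]}.
  apply: (@choice _ _ (fun Q q => [/\ record q, (Q < q)%N &
    forall n, record n -> (Q < n)%N -> (q <= n)%N])) => Q.
  case: (ex_minnP (recgt Q)) => n /andP[n1 n2] nmin.
  by exists n; split=> // l l1 l2; apply: nmin; rewrite l1.
(* A record above 1 secures [2 <= pr Q], so that [ln (pr Q)] is positive. *)
have [Q1 /andP[recQ1 Q1gt]] := recgt 1%N.
exists pr, nx, Q1 => Q Q1Q.
have Q0 : (0 < Q)%N by apply: leq_trans Q1Q; apply: ltnW.
have [p1 p2 p3] := prP _ Q0; have [n1 n2 n3] := nxP Q.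
have pr2 : (2 <= pr Q)%N by apply: (leq_trans Q1gt); apply: p3.
have pr0 : (0 < pr Q)%N by apply: ltnW.
split=> //.
- by rewrite pr2.
- have nx0 : (0 < nx Q)%N by apply: leq_ltn_trans n2.
  have [_ h1 h2] := prP _ nx0; apply/eqP; rewrite eqn_leq h1/=.
  exact: h2.
- move=> Q' QQ'; have [_ _ h] := prP Q' (leq_trans Q0 QQ').
  by apply: h => //; apply: leq_trans QQ'.
have [p pE] := dist_int_ex _ ((pr Q)%:R * x).
exists (p%:~R / (pr Q)%:R); first exact: leq_trans (denq_frac_le _ _ pr0) p2.
rewrite fmorph_div/= ratr_int ratr_nat.
have prR : 0 < (pr Q)%:R :> R by rewrite ltr0n.
have nxR : 0 < (nx Q)%:R :> R by rewrite ltr0n (leq_ltn_trans _ n2).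
have -> : x - p%:~R / (pr Q)%:R = ((pr Q)%:R * x - p%:~R) / (pr Q)%:R.
  by field; rewrite gt_eqF.
rewrite normrM normfV [`|_%:R|]gtr0_norm// pE ler_pdivrMr//.
rewrite invfM mulrA mulrAC divfK ?gt_eqF// -/(nu _).
(* Dirichlet's theorem is applied with [nx Q - 1], which keeps its [q] below the next record;
   [1 / (nx Q - 1) <= 2 / nx Q] produces the 2. *)
have h : (0 < (nx Q).-1)%N by move: n2 Q0; clear; lia.
have [q /andP[q0 qn] qe] := dirichlet_approx _ x _ h.
(* A denominator that is no record is matched or beaten by a smaller one; the descent ends at a
   record not above [pr Q]. *)
have best : forall j, (0 < j < nx Q)%N -> nu (pr Q) <= nu j.
  elim/ltn_ind => j IH /andP[j0 jn].
  have [rj|] := boolP (record j).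
    have jQ : (j <= Q)%N by rewrite leqNgt; apply/negP => /(n3 j rj); rewrite leqNgt jn.
    have := p3 j rj jQ; rewrite leq_eqVlt => /orP[/eqP->//|jp].
    by apply/ltW; have [_] := recP _ p1; apply; rewrite j0.
  rewrite /record j0/= => /forallPn[l]; rewrite negb_imply -leNgt => /andP[l0 lj].
  apply: le_trans lj; apply: IH => //; rewrite l0/=.
  by apply: ltn_trans jn.
apply: (le_trans (best q _)); first by rewrite q0/=; move: qn n2; clear; lia.
apply: (le_trans (ltW qe)).
rewrite ler_pdivlMr// mulrC ler_pdivrMr ?ltr0n// -natrM ler_nat.
by move: h; clear; lia.
Qed.

(** Fractions with denominator at most [M] lie in the lattice [Z / M!]. Near an irrational point
    heights are therefore large, which is what brings formulas valid for large [q] into play. *)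
Lemma rat_far (R : realType) (x : R) (M : nat) : ~ range (@ratr R) x ->
  exists2 eta, 0 < eta & forall r : rat, (`|denq r| <= M)%N -> eta <= `|x - ratr r|.
Proof.
move=> irr; pose D : R := M`!%:R.
have D0 : 0 < D by rewrite ltr0n fact_gt0.
exists (dist_int (D * x) / D).
  rewrite divr_gt0//; have [p pE] := dist_int_ex _ (D * x).
  rewrite -pE normr_gt0; apply/eqP => E; apply: irr.
  exists (p%:~R / M`!%:R) => //; rewrite fmorph_div/= ratr_int ratr_nat.
  have -> : p%:~R = D * x by apply/esym/eqP; rewrite -subr_eq0 E.
  by rewrite mulrAC divff ?mul1r// gt_eqF.
move=> r rM; rewrite ler_pdivrMr//.
have d0 : (0 < `|denq r|)%N by rewrite absz_gt0 denq_neq0.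
have /dvdnP[c cE] : (`|denq r| %| M`!)%N by apply: dvdn_fact; rewrite d0.
have -> : `|x - ratr r| * D = `|D * x - (c%:Z * numq r)%:~R|.
  rewrite -{1}[D]gtr0_norm// -normrM mulrC mulrBr; congr (`|_ - _|).
  rewrite /D cE /ratr natrM intrM mulrC.
  have -> : `|denq r|%:R = (denq r)%:~R :> R.
    by rewrite -[in RHS](gez0_abs (ltW (denq_gt0 r))).
  have dR : (denq r)%:~R != 0 :> R by rewrite intr_eq0 denq_neq0.
  by field.
exact: dist_int_le.
Qed.

(** * Approximation of every irrational point when C > 1 *)

Lemma row_norm_ge (R : realType) (d : nat) (x : 'rV[R]_d) (i : 'I_d) :
  `|x ord0 i| <= `|x|.
Proof.
rewrite /Num.norm/= mx_normrE.
exact: (le_bigmax _ (fun ij => `|x ij.1 ij.2|) (ord0, i)).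
Qed.

Lemma row_norm_witness (R : realType) (d : nat) (x : 'rV[R]_d) : x != 0 ->
  exists i, `|x| = `|x ord0 i|.
Proof.
move=> x0; have : mx_norm x != 0.
  by apply: contra x0 => /eqP/mx_norm_eq0/eqP.
by move=> /mx_norm_neq0[[i j]] /= E; exists j; rewrite (ord1 i) in E.
Qed.

Lemma irrational_coord (R : realType) (d : nat) (x : 'rV[R]_d) :
  irrational_points x -> exists i, ~ range (@ratr R) (x ord0 i).
Proof.
move=> irr; apply: contrapT => /forallNP H; apply: irr.
have [r rP] : {r : 'I_d -> rat & forall i, ratr (r i) = x ord0 i}.
  apply: (@choice _ _ (fun i q => ratr q = x ord0 i)) => i.
  by have /contrapT[q _ qE] := H i; exists q.
exists (\row_i r i) => //; apply/rowP => i.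
by rewrite !mxE rP.
Qed.

Lemma near_infty_ln (R : realType) (P : R -> Prop) :
  (\forall t \near +oo, P t) -> \forall q \near \oo, P (ln (q%:R : R)).
Proof.
move=> [M [_ MP]]; near=> q; apply: MP.
apply: (@lt_le_trans _ _ (M + 1)); first by rewrite ltrDl.
by apply: ge_expR_ln; near: q; apply: nbhs_infty_ger.
Unshelve. all: by end_near. Qed.

(** Suppose there is no such [r]. For each large [Q] the approximations attached to [pr i Q] form a
    rational point, and the coordinate attaining the norm of the error satisfies
    [ln pr + ln nx <= - ln psi + O(1)]. Jumping from [Q] to the next record of that coordinate gives
    a sequence excluded by [no_bad_sequence]. *)
Lemma approx_below (R : realType) (m N : nat) (gamma kappa : R) (psi : nat -> R)
    (x : 'rV[R]_m.+1) (delta eta : R) :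
  (0 < m)%N -> 1 < gamma -> gamma ^+ m.+1 = m%:R -> 0 < kappa ->
  (\forall q \near \oo, psi q = expR (- critical_exp m gamma kappa N.+1 (ln q%:R))) ->
  irrational_points x -> 0 < delta -> 0 < eta ->
  exists2 r, `|x - ratv R r| < eta & `|x - ratv R r| < delta * psi (Hmax r).
Proof.
move=> m0 g1 gm k0 psiE irr delta0 eta0; apply: contrapT => bad.
have {}bad r : `|x - ratv R r| < eta -> delta * psi (Hmax r) <= `|x - ratv R r|.
  by move=> re; rewrite leNgt; apply/negP => h; apply: bad; exists r.
pose good (i : 'I_m.+1) (z : (nat -> nat) * (nat -> nat) * nat) :=
  forall Q, (z.2 <= Q)%N ->
  [/\ (2 <= z.1.1 Q <= Q)%N, (Q < z.1.2 Q)%N, z.1.1 (z.1.2 Q) = z.1.2 Q,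
      forall Q', (Q <= Q')%N -> (z.1.1 Q <= z.1.1 Q')%N &
      exists2 r : rat, (`|denq r| <= Q)%N &
        `|x ord0 i - ratr r| <= 2 / ((z.1.1 Q)%:R * (z.1.2 Q)%:R)].
have [z zP] : {z & forall i, good i (z i)}.
  apply: choice => i; have [pr [nx [Q0 H]]] := approx_denominators _ (x ord0 i).
  by exists (pr, nx, Q0).
pose pr i := (z i).1.1; pose nx i := (z i).1.2.
pose Q0 := (\max_i (z i).2)%N.
have {}zP i Q : (Q0 <= Q)%N ->
  [/\ (2 <= pr i Q <= Q)%N, (Q < nx i Q)%N, pr i (nx i Q) = nx i Q,
      forall Q', (Q <= Q')%N -> (pr i Q <= pr i Q')%N &
      exists2 r : rat, (`|denq r| <= Q)%N &
        `|x ord0 i - ratr r| <= 2 / ((pr i Q)%:R * (nx i Q)%:R)].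
  by move=> QQ; apply: zP; apply: leq_trans QQ; apply: leq_bigmax.
pose crit := critical_exp m gamma kappa N.+1.
have [M0 _ M0P] : \forall q \near \oo, psi q = expR (- crit (ln q%:R)) /\
    (forall q', (q <= q')%N -> crit (ln q%:R) <= crit (ln q'%:R)).
  near=> q; split; first by near: q.
  move=> q' qq'; have q0 : (0 < q)%N by near: q; apply: nbhs_infty_gt.
  have : ln q%:R <= ln q'%:R :> R by apply: ler_lnM; rewrite ?ltr0n ?ler_nat.
  move: (ln q'%:R); near: q.
  exact: (near_infty_ln _ _ (critical_exp_mono _ _ N _ _ m0 g1 (ltW k0))).
(* The formula for [psi] holds from [M0] on; one irrational coordinate forces the height of a close
   point above [M0]. *)
have [i0 irr0] := irrational_coord _ _ _ irr.
have [eta' eta'0 far] := rat_far _ _ M0 irr0.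
pose K := ln (2 / delta).
have step : \forall Q \near \oo, exists i,
    ln (pr i Q)%:R + ln (nx i Q)%:R <= crit (ln Q%:R) + K.
  near=> Q.
  have Q0Q : (Q0 <= Q)%N by near: Q; apply: nbhs_infty_ge.
  have M0Q : (M0 <= Q)%N by near: Q; apply: nbhs_infty_ge.
  have Qpos : 0 < Q%:R :> R by near: Q; apply: nbhs_infty_gtr.
  have [r rP] : {r : 'I_m.+1 -> rat & forall i, (`|denq (r i)| <= Q)%N /\
        `|x ord0 i - ratr (r i)| <= 2 / ((pr i Q)%:R * (nx i Q)%:R)}.
    apply: (@choice _ _ (fun i q => (`|denq q| <= Q)%N /\
        `|x ord0 i - ratr q| <= 2 / ((pr i Q)%:R * (nx i Q)%:R))) => i.
    by have [_ _ _ _ [q q1 q2]] := zP i Q Q0Q; exists q.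
  pose rr : 'rV[rat]_m.+1 := \row_i r i.
  have xr i : (x - ratv R rr) ord0 i = x ord0 i - ratr (r i) by rewrite !mxE.
  have ne : x - ratv R rr != 0.
    by apply/eqP => /subr0_eq E; apply: irr; exists rr.
  have [i iE] := row_norm_witness _ _ _ ne.
  have [/andP[p2 pQ] Qn _ _ _] := zP i Q Q0Q.
  have [_ ri] := rP i.
  have pR : 1 <= (pr i Q)%:R :> R by rewrite ler1n ltnW.
  have p0 : 0 < (pr i Q)%:R :> R by rewrite (lt_le_trans ltr01).
  have nR : Q%:R <= (nx i Q)%:R :> R by rewrite ler_nat ltnW.
  have n0 : 0 < (nx i Q)%:R :> R by rewrite (lt_le_trans Qpos).
  have bnd : `|x - ratv R rr| <= 2 / ((pr i Q)%:R * (nx i Q)%:R) by rewrite iE xr.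
  have bQ : `|x - ratv R rr| <= 2 / Q%:R.
    apply: (le_trans bnd); rewrite ler_pM2l ?ltr0n// lef_pV2 ?posrE ?mulr_gt0//.
    by apply: (le_trans nR); rewrite ler_peMl// ltW.
  have small e : 0 < e -> 2 / e < Q%:R -> `|x - ratv R rr| < e.
    move=> e0 eQ; apply: (le_lt_trans bQ); rewrite ltr_pdivrMr//.
    by rewrite mulrC -ltr_pdivrMr.
  have eQ : `|x - ratv R rr| < eta by apply: small => //; near: Q; apply: nbhs_infty_gtr.
  have e'Q : `|x - ratv R rr| < eta'.
    by apply: small => //; near: Q; apply: nbhs_infty_gtr.
  have HM : (M0 <= Hmax rr)%N.
    apply: (@leq_trans `|denq (r i0)|%N).
      rewrite leqNgt; apply/negP => /ltnW/far; rewrite leNgt.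
      by rewrite -xr (le_lt_trans (row_norm_ge _ _ _ _) e'Q).
    have -> : r i0 = rr ord0 i0 by rewrite mxE.
    exact: (leq_bigmax i0).
  have HQ : (Hmax rr <= Q)%N.
    by apply/bigmax_leqP => j _; rewrite mxE; have [] := rP j.
  have [EH mono] := M0P _ HM.
  exists i; have := le_trans (bad _ eQ) bnd; rewrite EH.
  have /(ler_wpM2l (ltW delta0)) h :
      expR (- crit (ln Q%:R)) <= expR (- crit (ln (Hmax rr)%:R)).
    by rewrite ler_expR lerN2 mono.
  move=> /(le_trans h); rewrite ler_pdivlMr ?mulr_gt0//.
  rewrite mulrAC expRN ler_pdivrMr ?expR_gt0//.
  rewrite -ler_pdivlMl// => h2.
  have : ln ((pr i Q)%:R * (nx i Q)%:R) <= ln (delta^-1 * (2 * expR (crit (ln Q%:R)))).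
    by apply: ler_lnM => //; rewrite mulr_gt0.
  rewrite lnM ?posrE// mulrA lnM ?posrE ?expR_gt0 ?mulr_gt0 ?invr_gt0// expRK.
  by rewrite /K [delta^-1 * 2]mulrC addrC [X in _ <= X -> _]addrC [ln _ + ln _]addrC.
(* Half of [kappa] is spent on [K], that is, on the factors 2 and [delta]. *)
have k1 : 0 < kappa / 2 by rewrite divr_gt0.
pose crit1 := critical_exp m gamma (kappa / 2) N.+1.
have [T _ TP] : \forall Q \near \oo, [/\ (Q0 <= Q)%N, (2 <= Q)%N & exists i,
    ln (pr i Q)%:R + ln (nx i Q)%:R <= crit1 (ln Q%:R)].
  near=> Q; split; [by near: Q; apply: nbhs_infty_ge|by near: Q; apply: nbhs_infty_ge|].
  have [i h] : exists i, ln (pr i Q)%:R + ln (nx i Q)%:R <= crit (ln Q%:R) + K by near: Q.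
  exists i; apply: (le_trans h); near: Q.
  apply: (near_infty_ln _ _ (critical_exp_gap _ _ N.+1 _ _ _ K m0 g1 _)).
  by rewrite ltr_pdivrMr// ltr_pMr// ltr1n.
have [w wP] : {w : nat -> 'I_m.+1 & forall Q, (T <= Q)%N ->
    ln (pr (w Q) Q)%:R + ln (nx (w Q) Q)%:R <= crit1 (ln Q%:R)}.
  apply: (@choice _ _ (fun Q i => (T <= Q)%N ->
    ln (pr i Q)%:R + ln (nx i Q)%:R <= crit1 (ln Q%:R))) => Q.
  case: (leqP T Q) => TQ; last by exists ord0.
  by have [_ _ [i h]] := TP Q TQ; exists i.
pose Qs := fix Qs k := if k is k'.+1 then nx (w (Qs k')) (Qs k') else T.
have QsT k : (T + k <= Qs k)%N.
  elim: k => [|k IH]; first by rewrite addn0.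
  have TQ : (T <= Qs k)%N by apply: leq_trans IH; apply: leq_addr.
  have [Q0Q _ _] := TP _ TQ; have [_ h _ _ _] := zP (w (Qs k)) _ Q0Q.
  by rewrite addnS; apply: leq_ltn_trans IH h.
have QsT' k : (T <= Qs k)%N by apply: leq_trans (QsT k); apply: leq_addr.
have Qs2 k : (2 <= Qs k)%N by have [] := TP _ (QsT' k).
pose t k : R := ln (Qs k)%:R.
pose idx k := w (Qs k).
(* Only updates of the coordinate in use are kept. Others may improve meanwhile, but [pr] is
   monotone, so [P] stays a lower bound for [ln pr]; it starts at [ln 2] because [2 <= pr]. *)
pose P := fix P k (i : 'I_m.+1) : R :=
  if k is k'.+1 then (if i == idx k' then t k else P k' i) else ln 2.
have tS k : t k <= t k.+1.
  have [Q0Q _ _] := TP _ (QsT' k); have [_ h _ _ _] := zP (w (Qs k)) _ Q0Q.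
  by apply: ler_lnM; rewrite ?ltr0n ?ler_nat ?(ltnW h)// (ltn_trans _ (Qs2 k)).
have Ppr k i : P k i <= ln (pr i (Qs k))%:R.
  elim: k i => [|k IH] i.
    have [Q0Q _ _] := TP _ (QsT' 0%N); have [/andP[h _] _ _ _ _] := zP i _ Q0Q.
    by apply: ler_lnM; rewrite ?ltr0n// ler_nat.
  have [Q0Q _ _] := TP _ (QsT' k).
  rewrite /=; case: eqP => [->|_].
    have [_ _ h _ _] := zP (w (Qs k)) _ Q0Q.
    by rewrite /t /= /idx h.
  apply: (le_trans (IH i)).
  have [/andP[h _] _ _ hm _] := zP i _ Q0Q.
  apply: ler_lnM; first by rewrite ltr0n (ltn_trans _ h).
  rewrite ler_nat; apply: hm.
  by have [_ h' _ _ _] := zP (w (Qs k)) _ Q0Q; apply: ltnW.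
apply: (@no_bad_sequence R m N gamma (kappa / 2) (ln 2) t idx P) => //.
- by apply: ln_gt0; rewrite ltr1n.
- by apply: ler_lnM; rewrite ?ltr0n// ler_nat.
- move=> A; near=> k; apply: ge_expR_ln.
  apply: (@le_trans _ _ k%:R); first by near: k; apply: nbhs_infty_ger.
  by rewrite ler_nat; apply: leq_trans (QsT k); apply: leq_addl.
- move=> k; rewrite addrC; apply: le_trans (wP _ (QsT' k)).
  by rewrite lerD2r Ppr.
Unshelve. all: by end_near. Qed.

(** * A solution of the delay inequality when C <= 1 *)

(* g / y >= theta * B is preserved by one step of the recurrence
   y' = y + g, g' = g - theta^2 (q + s'^-3) y' defining barrier_sequence; the term
   s'^-3 and the discretization errors are paid for by the extra level q' - q. *)
Lemma barrier_invariant (R : realType) (theta s' B B' q q' A X y g : R) :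
  0 < theta -> 1 <= s' -> 0 <= B' -> s' * B' <= 1 -> 0 <= q -> q <= q' ->
  q' <= A / s' ^+ 2 -> theta + theta ^+ 2 * (A + 1) <= s' ->
  (1 + theta * (1 + A) + theta * (A + 1) * (1 + theta * (1 + A))) / s' ^+ 3 <= q' - q ->
  B' + theta * (B' ^+ 2 + q') <= B -> 0 < y -> theta * B * y <= g ->
  theta * B' * (y + g) <= g - theta ^+ 2 * (q + s' ^- 3) * (y + g).
Proof.
move=> th0 s1 B'0 sB q0 qq' q'A slarge gap step y0 gB.
have s0 : 0 < s' by apply: lt_le_trans s1.
pose r := s'^-1.
have r0 : 0 < r by rewrite invr_gt0.
have rE : s' * r = 1 by rewrite divff ?gt_eqF.
have r1 : r <= 1 by rewrite invf_le1.
have B'r : B' <= r by rewrite -(ler_pM2l s0) rE.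
rewrite -[s' ^- 3]exprVn -/r.
rewrite -exprVn -/r in q'A; rewrite -[in X in X <= _]exprVn -/r in gap.
set Z := B' + theta * (B' ^+ 2 + q') in step.
have A0 : 0 <= A.
  by rewrite -(pmulr_lge0 _ (exprn_gt0 2 r0)) (le_trans _ q'A)// (le_trans q0).
have r2 : 0 < r ^+ 2 by rewrite exprn_gt0.
have r3 : r ^+ 3 = r * r ^+ 2 by rewrite exprS.
have r3le : r ^+ 3 <= r ^+ 2 by rewrite r3 ler_piMl ?(ltW r2).
have r2le : r ^+ 2 <= r by rewrite expr2 ler_piMl ?(ltW r0).
have B2 : B' ^+ 2 <= r ^+ 2 by rewrite lerXn2r ?nnegrE ?(ltW r0).
have hZ : B' ^+ 2 + q' <= (1 + A) * r ^+ 2 by lra.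
have Bq0 : 0 <= B' ^+ 2 + q' by rewrite addr_ge0 ?sqr_ge0// (le_trans q0).
have Z0 : 0 <= Z by rewrite addr_ge0// mulr_ge0// ltW.
have A10 : 0 <= 1 + A by rewrite addr_ge0.
have Zr : Z <= (1 + theta * (1 + A)) * r.
  have h1 := ler_wpM2l (ltW th0) hZ.
  have h2 := ler_wpM2l (mulr_ge0 (ltW th0) A10) r2le.
  by rewrite /Z; lra.
have qr : q + r ^+ 3 <= (A + 1) * r ^+ 2 by lra.
have qr0 : 0 <= q + r ^+ 3 by rewrite addr_ge0// exprn_ge0// ltW.
pose W := theta * B' + theta ^+ 2 * (q + r ^+ 3).
have W1 : W <= 1.
  have h1 := ler_wpM2l (ltW th0) B'r.
  have h2 := ler_wpM2l (sqr_ge0 theta) qr.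
  have h3 : theta ^+ 2 * ((A + 1) * r ^+ 2) <= theta ^+ 2 * ((A + 1) * r).
    by rewrite ler_wpM2l ?sqr_ge0// ler_wpM2l// addr_ge0.
  have := ler_wpM2r (ltW r0) slarge; rewrite rE /W; lra.
(* The claim for the extreme slope [Z], where the budget [q' - q] is spent. As [W <= 1], it extends
   to every [B >= Z] and then to every [g >= theta * B * y]. *)
have main : W * (1 + theta * Z) <= theta * Z.
  have e1 : B' * (B' ^+ 2 + q') <= r * ((1 + A) * r ^+ 2) by rewrite ler_pM.
  have e2 : (q + r ^+ 3) * Z <= (A + 1) * r ^+ 2 * ((1 + theta * (1 + A)) * r).
    by rewrite ler_pM.
  have e3 : r ^+ 3 + theta * (B' * (B' ^+ 2 + q')) + theta * ((q + r ^+ 3) * Z) <= q' - q.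
    apply: le_trans gap.
    have := ler_wpM2l (ltW th0) e1; have := ler_wpM2l (ltW th0) e2.
    rewrite r3; lra.
  have := ler_wpM2l (sqr_ge0 theta) e3.
  rewrite -subr_ge0 => h; rewrite -subr_ge0; apply: le_trans h _.
  rewrite le_eqVlt; apply/orP; left; apply/eqP; rewrite /W /Z; ring.
have main2 : W * (1 + theta * B) <= theta * B.
  have : 0 <= (1 - W) * (theta * (B - Z)).
    by rewrite mulr_ge0 ?subr_ge0// mulr_ge0 ?subr_ge0// ltW.
  by move: main; lra.
have main3 := ler_wpM2r (ltW y0) main2.
have : 0 <= (1 - W) * (g - theta * B * y) by rewrite mulr_ge0 ?subr_ge0.
by move: main3; rewrite /W; lra.
Qed.

(** As [c] is nonincreasing, [g (n + j)] is at least [g (n + m) + (m - j) * c (n + m)]; the weights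
    [m - j] sum to [m (m + 1) / 2]. *)
Lemma barrier_window (R : realType) (g c : nat -> R) (m n : nat) :
  (forall k, g k.+1 + c k.+1 = g k) -> (forall k, c k.+1 <= c k) ->
  m%:R * g (n + m)%N + m%:R * m.+1%:R / 2 * c (n + m)%N <= \sum_(j < m) g (n + j)%N.
Proof.
move=> gS cS; elim: m => [|m IH]; first by rewrite big_ord0 !mul0r addr0.
rewrite big_ord_recr/= addnS; have E := gS (n + m)%N.
have m0 : 0 <= m%:R :> R by rewrite ler0n.
have mm0 : 0 <= m%:R * m.+1%:R / 2 :> R by rewrite divr_ge0 ?mulr_ge0 ?ler0n.
have := ler_wpM2l mm0 (cS (n + m)%N); move: IH.
rewrite -E -[m.+2%:R]natr1 -[m.+1%:R]natr1; lra.
Qed.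

(** [T] lists the log-denominators of the point to be built. The room [A] absorbs constant factors,
    and the shift by 2 the discrepancy between a height and the denominators near it. *)
Lemma barrier_sequence (R : realType) (m N : nat) (gamma : R) :
  (1 < m)%N -> 1 < gamma -> gamma ^+ m.+1 = m%:R ->
  exists T : nat -> R,
  [/\ forall k, 0 <= T k <= T k.+1,
      forall k, T k + 2 <= T (k + m.+1)%N,
      forall A, \forall k \near \oo, A <= T k &
      forall A, \forall n \near \oo, forall t, T (n + m)%N - 2 <= t ->
        T (n + m).+1 + T n + A <= critical_exp m gamma 0 N.+1 t].
Proof.
move=> m1 g1 gm.
have m0 : (0 < m)%N by apply: ltnW.
have mR : 0 < m%:R :> R by rewrite ltr0n.
have g0 : 0 < gamma by apply: lt_trans g1.
have th0 : 0 < ln gamma by apply: ln_gt0.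
have [A A0 AP] := logq_le_sqr R 0 N.+1 (lexx _).
set theta := ln gamma in th0.
pose A1 := 1 + theta * (1 + A) + theta * (A + 1) * (1 + theta * (1 + A)).
pose good s := [/\ 1 <= s, theta + theta ^+ 2 * (A + 1) <= s, ln 2 <= s &
  [/\ logq 0 N.+2 s <= A / s ^+ 2, A1 / s ^+ 3 <= logq 0 N.+2 s - logq 0 N.+1 s,
     0 < s * barrier N.+2 s <= 1,
     forall s', s <= s' -> barrier N.+2 s' + (s' - s) *
       (barrier N.+2 s' ^+ 2 + logq 0 N.+2 s') <= barrier N.+2 s &
  [/\ forall s', s <= s' -> s' ^+ 2 * logq 0 N.+1 s' <= s ^+ 2 * logq 0 N.+1 s,
     forall s', s <= s' -> logq 0 N.+1 s' <= logq 0 N.+1 s &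
     0 <= 1 - m%:R * theta ^+ 2 / 2 * logq 0 N.+1 s]]].
have ngood : \forall s \near +oo, good s.
  near=> s; split; [near: s; exact: near_pinfty_ge..|split; last split]; near: s => //.
  - exact: logq0_gap.
  - exact: barrierS_bounds.
  - exact: barrier_step.
  - exact: logq_sqr_noninc.
  - exact: logq_noninc.
  - exact: critical_factor_ge0.
have [C [_ CP]] := ngood.
have [n0 n00 n0C] : exists2 n0, (0 < n0)%N & C < theta * n0%:R.
  exists (Num.bound (`|C| / theta)).+1 => //.
  rewrite mulrC -ltr_pdivrMr//.
  apply: (@le_lt_trans _ _ (`|C| / theta)).
    by rewrite ler_wpM2r ?ler_norm// invr_ge0 ltW.
  apply: (lt_trans (archi_boundP _)); first by rewrite divr_ge0// ltW.
  by rewrite ltr_nat.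
pose s n := theta * (n0 + n)%:R.
have sS n : s n.+1 = s n + theta by rewrite /s addnS -natr1 mulrDr mulr1.
have sgood n : good (s n).
  by apply: CP; apply: (lt_le_trans n0C); rewrite ler_pM2l// ler_nat leq_addr.
have s0 n : 0 < s n by have [h _ _ _] := sgood n; apply: lt_le_trans h.
pose B n := barrier N.+2 (s n).
(* The additional [s^-3] creates the room that later exceeds every constant [A]. *)
pose Q n := theta ^+ 2 * (logq 0 N.+1 (s n) + s n ^- 3).
have q0 n : 0 <= logq (0 : R) N.+1 (s n) by apply: logq_ge0.
have Q0 n : 0 <= Q n.
  by rewrite mulr_ge0 ?sqr_ge0// addr_ge0// invr_ge0 exprn_ge0// ltW.
pose yg := fix yg n : R * R := if n is n'.+1 then
  ((yg n').1 + (yg n').2, (yg n').2 - Q n * ((yg n').1 + (yg n').2))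
  else (2, theta * B 0%N * 2).
pose y n := (yg n).1; pose g n := (yg n).2.
have yS n : y n.+1 = y n + g n by [].
have gS n : g n.+1 = g n - Q n.+1 * y n.+1 by [].
have B0 n : 0 < B n.
  by have [_ _ _ [_ _ /andP[h _] _ _]] := sgood n; rewrite -(pmulr_rgt0 _ (s0 n)).
(* The barrier clause keeps [g] positive forever; the last clause is concavity and makes [y / s]
   nonincreasing. *)
have inv n : [/\ 2 <= y n, theta * B n * y n <= g n & (n0 + n)%:R * g n <= y n].
  elim: n => [|n [y2 h1 h2]].
    have [_ _ _ [_ _ /andP[_ h] _ _]] := sgood 0%N.
    split; rewrite /y /g//=.
    by move: h; rewrite -/(B 0%N) {1}/s; lra.
  have y0 : 0 < y n by apply: lt_le_trans y2.
  have g0' : 0 <= g n :=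
    le_trans (mulr_ge0 (mulr_ge0 (ltW th0) (ltW (B0 n))) (ltW y0)) h1.
  have y2' : 2 <= y n.+1 by rewrite yS (le_trans y2)// lerDl.
  split=> //.
    have [a1 a2 _ [a3 a4 /andP[_ a5] _ _]] := sgood n.+1.
    have [_ _ _ [_ _ _ a6 _]] := sgood n.
    rewrite gS yS.
    apply: (@barrier_invariant R theta (s n.+1) (B n) (B n.+1)
      (logq 0 N.+1 (s n.+1)) (logq 0 N.+2 (s n.+1)) A) => //.
    - exact: ltW.
    - rewrite -subr_ge0; apply: le_trans a4.
      rewrite divr_ge0 ?exprn_ge0 ?(ltW (s0 _))// /A1.
      have h3 := mulr_ge0 (ltW th0) (addr_ge0 ler01 (ltW A0)).
      have h4 := addr_ge0 ler01 h3.
      by apply: addr_ge0 => //; apply: mulr_ge0 => //; rewrite addrC.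
    - have := a6 (s n.+1); rewrite sS lerDl (ltW th0) => /(_ isT).
      by rewrite [s n + theta - s n]addrAC subrr add0r -sS.
  rewrite gS addnS -natr1 mulrDl mul1r.
  have y0' : 0 < y n.+1 by apply: lt_le_trans y2'.
  have := mulr_ge0 (Q0 n.+1) (ltW y0').
  have := mulr_ge0 (ler0n R (n0 + n)%N) (mulr_ge0 (Q0 n.+1) (ltW y0')).
  move: h2; rewrite [in X in _ -> _ -> _ -> _ <= X]yS; lra.
have y0 n : 0 < y n by have [h _ _] := inv n; apply: lt_le_trans h.
have gn0 n : 0 <= g n.
  have [_ h _] := inv n.
  exact: le_trans (mulr_ge0 (mulr_ge0 (ltW th0) (ltW (B0 n))) (ltW (y0 n))) h.
pose c n := Q n * y n.
(* [Q y = (s^2 Q) * (y / s) * (1 / s)] is a product of nonincreasing factors. *)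
have cS n : c n.+1 <= c n.
  have [_ _ h] := inv n.
  have [_ _ _ [_ _ _ _ [h1 _ _]]] := sgood n.
  have ss : s n <= s n.+1 by rewrite sS lerDl ltW.
  have Qs : Q n.+1 * s n.+1 ^+ 2 <= Q n * s n ^+ 2.
    rewrite /Q -[leLHS]mulrA -[leRHS]mulrA (ler_wpM2l (sqr_ge0 theta))//.
    rewrite [leLHS]mulrDl [leRHS]mulrDl lerD//.
      by rewrite mulrC [leRHS]mulrC h1.
    have r3 (z : R) : 0 < z -> z ^- 3 * z ^+ 2 = z^-1.
      by move=> z0; field; rewrite gt_eqF.
    by rewrite !r3// lef_pV2 ?posrE.
  have yy : y n.+1 * s n <= y n * s n.+1.
    have := ler_wpM2l (ltW th0) h.
    rewrite yS sS /s; lra.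
  have sq : 0 < s n ^+ 2 by rewrite exprn_gt0.
  rewrite -(ler_pM2r sq) /c.
  have e1 := ler_pM (mulr_ge0 (ltW (y0 _)) (ltW (s0 _))) (ltW (s0 _)) yy ss.
  have e2 := ler_wpM2l (Q0 n.+1) e1.
  have e3 := ler_wpM2r (ltW (y0 n)) Qs.
  move: e2 e3; clear.
  move: (s n) (s n.+1) (y n) (y n.+1) (Q n) (Q n.+1) => *; lra.
pose M : R := m%:R * m.+1%:R / 2.
have win n : m%:R * y (n + m).+1 + y n <= m.+1%:R * y (n + m)%N - M * c (n + m)%N.
  have gc k : g k.+1 + c k.+1 = g k by rewrite gS /c subrK.
  have := barrier_window _ g c m n gc cS.
  have yE : y (n + m)%N = y n + \sum_(j < m) g (n + j)%N.
    elim: (m) => [|j IH]; first by rewrite addn0 big_ord0 addr0.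
    by rewrite addnS yS IH big_ord_recr/= addrA.
  rewrite yS -/M -[m.+1%:R]natr1; move: (\sum_(_ < _) _) yE => S yE; lra.
have es n : expR (s n) = gamma ^+ (n0 + n)%N by rewrite expRM_natr lnK// posrE.
pose T n := gamma ^+ (n0 + n)%N * y n.
have gp n : 0 < gamma ^+ n by rewrite exprn_gt0.
have Tge n : 2 * expR (s n) <= T n.
  by rewrite es mulrC /T ler_pM2l//; have [] := inv n.
have T0 n : 0 < T n by rewrite mulr_gt0.
have es2 n : 2 <= expR (s n).
  by have [_ _ h _] := sgood n; rewrite -[leLHS]lnK ?posrE// ler_expR.
have TS n : T n <= T n.+1.
  rewrite /T addnS; apply: ler_pM; rewrite ?(ltW (gp _)) ?(ltW (y0 _))//.
    by rewrite exprS ler_peMl ?(ltW (gp _)) ?(ltW g1).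
  by rewrite yS lerDl.
have ymono n j : y n <= y (n + j)%N.
  by elim: j => [|j IH]; rewrite ?addn0// addnS yS (le_trans IH)// lerDl.
exists T; split; first by move=> k; rewrite (ltW (T0 k)) TS.
- move=> k; apply: (@le_trans _ _ (T k * 2)).
    by rewrite mulr_natr mulr2n lerD2l (le_trans _ (Tge k))//; have := es2 k; lra.
  apply: (@le_trans _ _ (T k * m%:R)).
    by rewrite ler_wpM2l ?(ltW (T0 k))// ler_nat.
  rewrite -gm /T mulrAC -exprD -addnA ler_wpM2l ?(ltW (gp _))//.
- move=> A'; near=> k; apply: (@le_trans _ _ (s k)).
    rewrite /s natrD mulrDr.
    apply: (@le_trans _ _ (theta * k%:R)); last by rewrite lerDr mulr_ge0 ?ler0n// ltW.
    rewrite -ler_pdivrMl//; near: k; exact: nbhs_infty_ger.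
  by have := Tge k; have := expR_ge1Dx (s k); have := s0 k; lra.
pose w := m.+1%:R * gamma / m%:R.
have w0 : 0 < w by rewrite divr_gt0// mulr_gt0 ?ltr0n.
pose cc := m%:R * theta ^+ 2 / 2.
have cc0 : 0 < cc by rewrite divr_gt0// mulr_gt0// exprn_gt0.
move=> A'.
have [L [_ LP]] := near_ln_cube R ((`|A'| + 2 * w) / (w * cc)).
near=> n => t Tt.
have nL : `|L| / theta <= n%:R by near: n; exact: nbhs_infty_ger.
set k := (n + m)%N in Tt *.
have Tk := Tge k; have ek := es2 k.
(* As [y k >= 2] and [expR (s k) >= 2], even [T k - 2] is at least [expR (s k)]. *)
have est : expR (s k) <= t by lra.
have t0 : 0 < t by apply: lt_le_trans est; exact: expR_gt0.
have lt : s k <= ln t by apply: ge_expR_ln.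
have [_ _ _ [_ _ _ _ [_ h2 h3]]] := sgood k.
have qle := h2 _ lt.
have lower : T k.+1 + T n <= w * T k * (1 - cc * (logq 0 N.+1 (s k) + s k ^- 3)).
  have -> : T k.+1 + T n = gamma ^+ (n0 + k)%N * (gamma / m%:R) * (m%:R * y k.+1 + y n).
    have e1 : gamma ^+ (n0 + k.+1) = gamma ^+ (n0 + k) * (gamma / m%:R) * m%:R.
      by rewrite addnS exprS; field; rewrite gt_eqF.
    have e2 : gamma ^+ (n0 + n) = gamma ^+ (n0 + k) * (gamma / m%:R).
      rewrite /k addnA [in RHS]exprD mulrA -[_ * gamma]mulrA -exprSr gm mulfK//.
      by rewrite gt_eqF.
    by rewrite /T e1 e2 -/k; ring.
  apply: (le_trans (ler_wpM2l _ (win n))).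
    by rewrite mulr_ge0 ?(ltW (gp _))// divr_ge0 ?(ltW g0) ?(ltW mR).
  rewrite le_eqVlt; apply/orP; left; apply/eqP; rewrite -/k /T /w /cc /c /Q /M.
  by move: (s k ^- 3) => z; field; rewrite gt_eqF.
have upper : w * (T k - 2) * (1 - cc * logq 0 N.+1 (s k)) <=
    critical_exp m gamma 0 N.+1 t.
  apply: ler_pM => //.
  - by apply: mulr_ge0 (ltW w0) _; lra.
  - by rewrite ler_wpM2l ?(ltW w0).
  - by rewrite lerD2l lerN2 ler_wpM2l ?(ltW cc0).
apply: le_trans upper.
(* [2 * w] is the loss from [T k - 2] in place of [T k]; the [s^-3] term, multiplied by [T k],
   covers it together with [A']. *)
have big : A' + 2 * w <= w * T k * (cc * s k ^- 3).
  have h4 : (`|A'| + 2 * w) / (w * cc) * s k ^+ 3 <= expR (s k).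
    rewrite -{1}[s k]expRK; apply: LP.
    apply: lt_le_trans (expR_ge1Dx _).
    have h5 : theta * n%:R <= s k by rewrite ler_pM2l// ler_nat /k addnCA leq_addr.
    have h6 := ler_norm L.
    move: nL; rewrite ler_pdivrMr//; lra.
  have s3 : 0 < s k ^+ 3 by rewrite exprn_gt0.
  have wc : 0 < w * cc by rewrite mulr_gt0.
  apply: (@le_trans _ _ (`|A'| + 2 * w)); first by rewrite lerD2r ler_norm.
  have -> : w * T k * (cc * s k ^- 3) = w * cc * T k / s k ^+ 3.
    by move: (s k ^+ 3)^-1 => z; ring.
  rewrite ler_pdivlMr// -ler_pdivrMl// mulrA [_^-1 * _]mulrC (le_trans h4)//; lra.
have q1 : 0 <= w * (cc * logq 0 N.+1 (s k)).
  by rewrite mulr_ge0 ?(ltW w0)// mulr_ge0 ?(ltW cc0).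
move: lower; lra.
Unshelve. all: by end_near. Qed.

(* The convergents of a continued fraction with all signs negative: the
   recurrence u |-> a u - u' preserves the determinant p q' - p' q = 1. *)
Lemma prescribed_convergents (R : realType) (E : nat -> R) :
  (forall n, 1 <= E n) -> (forall n, 4 * E n <= E n.+1) ->
  exists p q : nat -> int, forall n,
    [/\ E n <= (q n)%:~R, (q n)%:~R <= 2 * E n & p n.+1 * q n - p n * q n.+1 = 1].
Proof.
move=> E1 ES.
pose inv n (z : int * int * int * int) := [/\ E n <= z.2%:~R, z.2%:~R <= 2 * E n &
  z.1.2 * z.1.1.2 - z.1.1.1 * z.2 = 1].
have next n z : exists z', inv n z -> inv n.+1 z' /\ (z'.1.1.1 = z.1.2 /\ z'.1.1.2 = z.2).
  case: z => [[[p' q'] p] q].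
  (* The new denominator falls in [[E n.+1, E n.+1 + q)], and [q <= 2 * E n <= E n.+1 / 2]. *)
  pose a := Num.ceil ((E n.+1 + q'%:~R) / q%:~R).
  exists (p, q, a * p - p', a * q - q') => -[/= h1 h2 h3].
  have q0 : 0 < q%:~R :> R by apply: lt_le_trans h1; apply: lt_le_trans (E1 n).
  have /andP[] := ceil_itv ((E n.+1 + q'%:~R) / q%:~R); rewrite -/a.
  rewrite ltr_pdivlMr// ler_pdivrMr// intrB => a1 a2.
  split=> //; split => /=; rewrite ?intrB ?intrM.
  - lra.
  - have := ES n; lra.
  - by rewrite -h3; ring.
have [f fP] : {f : nat * (int * int * int * int) -> int * int * int * int & forall nz,
    inv nz.1 nz.2 -> inv nz.1.+1 (f nz) /\
    ((f nz).1.1.1 = nz.2.1.2 /\ (f nz).1.1.2 = nz.2.2)}.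
  apply: (@choice _ _ (fun nz z' => inv nz.1 nz.2 -> inv nz.1.+1 z' /\
    (z'.1.1.1 = nz.2.1.2 /\ z'.1.1.2 = nz.2.2))).
  by move=> nz; apply: next.
pose st := fix st n := if n is n'.+1 then f (n', st n') else
  (0, 1, 1, Num.ceil (E 0%N)) : int * int * int * int.
have st0 n : inv n (st n).
  elim: n => [|n IH]; last by have [] := fP (n, st n) IH.
  have /andP[a1 a2] := ceil_itv (E 0%N); rewrite intrB in a1.
  by split => //=; [have := E1 0%N; lra|rewrite mul1r mul0r subr0].
exists (fun n => (st n).1.2), (fun n => (st n).2) => n.
have [h1 h2 h3] := st0 n; split=> //.
have [_ _ h] := st0 n.+1; have [_ [e1 e2]] := fP (n, st n) (st0 n).
by rewrite -h [in RHS]/= e1 e2.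
Qed.

(** The limit [x] of the convergents [c n] satisfies [1 / (Q Q') <= x - c n <= 2 / (Q Q')] for
    consecutive denominators [Q], [Q']. A fraction other than [c n] with [3 * denq r <= Q'] is at
    least [3 / (Q Q')] away from [c n], hence at least [1 / (Q Q')] away from [x]. *)
Lemma badly_approximable (R : realType) (E : nat -> R) :
  (forall n, 1 <= E n) -> (forall n, 4 * E n <= E n.+1) ->
  exists x : R, forall n (r : rat), 3 * (`|denq r|%N)%:R <= E n.+1 ->
    (4 * E n * E n.+1)^-1 <= `|x - ratr r|.
Proof.
move=> E1 ES; have [p [q pq]] := prescribed_convergents _ _ E1 ES.
pose Q n : R := (q n)%:~R.
have E0 n : 0 < E n by apply: lt_le_trans (E1 n).
have Q0 n : 0 < Q n by have [h _ _] := pq n; apply: lt_le_trans h.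
have QS n : 2 * Q n <= Q n.+1.
  by have [_ h _] := pq n; have [h' _ _] := pq n.+1; have := ES n; rewrite /Q; lra.
pose c n : R := (p n)%:~R / Q n.
have cS n : c n.+1 = c n + (Q n * Q n.+1)^-1.
  have [_ _ h] := pq n.
  have /(congr1 (fun z : int => z%:~R : R)) : p n.+1 * q n - p n * q n.+1 = 1 := h.
  rewrite intrB !intrM -/(Q n) -/(Q n.+1) => h'.
  apply/eqP; rewrite -subr_eq0; apply/eqP.
  have -> : c n.+1 - (c n + (Q n * Q n.+1)^-1) =
     ((p n.+1)%:~R * Q n - (p n)%:~R * Q n.+1 - 1) / (Q n * Q n.+1).
    by rewrite /c; field; rewrite !gt_eqF ?Q0.
  by rewrite h' subrr mul0r.
have QQ n : 0 < (Q n * Q n.+1)^-1 by rewrite invr_gt0 mulr_gt0.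
pose D n := c n + 2 * (Q n * Q n.+1)^-1.
have DS n : D n.+1 <= D n.
  rewrite /D cS -addrA lerD2l.
  have h : (Q n.+1 * Q n.+2)^-1 <= (2 * (Q n * Q n.+1))^-1.
    rewrite lef_pV2 ?posrE ?mulr_gt0//.
    have := ler_wpM2r (ltW (Q0 n.+1)) (QS n).
    have := ler_wpM2l (ltW (Q0 n.+1)) (QS n.+1).
    have := mulr_gt0 (Q0 n.+1) (Q0 n.+1); lra.
  have e : (2 * (Q n * Q n.+1))^-1 = 2^-1 * (Q n * Q n.+1)^-1 by rewrite invfM.
  by rewrite e in h; lra.
have cD k n : c k <= D n.
  have cm j i : c i <= c (i + j)%N.
    by elim: j => [|j IH]; rewrite ?addn0// addnS cS (le_trans IH)// lerDl ltW.
  have Dm j i : D (i + j)%N <= D i.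
    by elim: j => [|j IH]; rewrite ?addn0// addnS (le_trans (DS _)).
  apply: (@le_trans _ _ (c (k + n)%N)); first exact: cm.
  apply: (@le_trans _ _ (D (k + n)%N)); first by rewrite lerDl mulr_ge0 ?(ltW (QQ _)).
  by rewrite addnC Dm.
pose x := sup (range c).
have cx n : c n <= x.
  apply: ub_le_sup; last by exists n.
  by exists (D 0%N) => _ [k _ <-].
have xD n : x <= D n.
  apply: ge_sup; first by exists (c 0%N); exists 0%N.
  by move=> _ [k _ <-].
exists x => n r rE.
have low : (Q n * Q n.+1)^-1 <= x - c n by have := cx n.+1; rewrite cS; lra.
have up : x - c n <= 2 * (Q n * Q n.+1)^-1 by have := xD n; rewrite /D; lra.
have [q1 q2 _] := pq n; have [q1' q2' _] := pq n.+1.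
apply: (@le_trans _ _ (Q n * Q n.+1)^-1).
  rewrite lef_pV2 ?posrE ?mulr_gt0//.
  have -> : 4 * E n * E n.+1 = (2 * E n) * (2 * E n.+1) by ring.
  by apply: ler_pM => //; apply: ltW.
have [rc|rc] := eqVneq (ratr r) (c n).
  by rewrite rc (le_trans low)// ler_norm.
set b : R := (`|denq r|%N)%:R in rE.
have bE : b = (denq r)%:~R by rewrite /b -[in RHS](gez0_abs (ltW (denq_gt0 r))).
have b0 : 0 < b by rewrite bE ltr0z denq_gt0.
have far : (b * Q n)^-1 <= `|ratr r - c n|.
  have e : ratr r - c n = (numq r * q n - p n * denq r)%:~R / (b * Q n).
    have aux (z u v w : R) : 0 < z -> 0 < w -> u / w - v / z = (u * z - v * w) / (w * z).
      by move=> z0 w0; field; rewrite !gt_eqF.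
    by rewrite /ratr /c intrB !intrM -bE aux.
  have z0 : numq r * q n - p n * denq r != 0.
    apply/eqP => z; move: e; rewrite z mul0r => /eqP; rewrite subr_eq0.
    by rewrite (negbTE rc).
  have bq : 0 < b * Q n by rewrite mulr_gt0.
  rewrite e normrM normfV [`|b * _|]gtr0_norm// ler_peMl ?invr_ge0 ?(ltW bq)//.
  rewrite -intr_norm ler1z -gtz0_ge1 normr_gt0//.
have far3 : 3 * (Q n * Q n.+1)^-1 <= `|ratr r - c n|.
  apply: le_trans far.
  have -> : 3 * (Q n * Q n.+1)^-1 = (Q n * (Q n.+1 / 3))^-1.
    by move: (Q0 n) (Q0 n.+1) => z0 w0; field; rewrite !gt_eqF.
  rewrite lef_pV2 ?posrE ?mulr_gt0 ?divr_gt0// mulrC ler_pM2l//.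
  by rewrite ler_pdivlMr//; rewrite /Q; lra.
have tri : `|ratr r - c n| <= `|x - ratr r| + `|x - c n|.
  have -> : ratr r - c n = - (x - ratr r) + (x - c n) by ring.
  by apply: le_trans (ler_normD _ _) _; rewrite normrN.
have : `|x - c n| = x - c n by rewrite ger0_norm// subr_ge0.
move: tri far3 up; lra.
Qed.

Lemma expR2_ge4 (R : realType) : 4 <= expR 2 :> R.
Proof.
have -> : 2 = 1 * 2%:R :> R by rewrite mul1r.
rewrite expRM_natr; have := expR_ge1Dx (1 : R) => h.
have : (1 + 1) ^+ 2 <= expR 1 ^+ 2 :> R by rewrite lerXn2r ?nnegrE ?expR_ge0.
lra.
Qed.

(** Denominators close to [expR (T k)] are dealt cyclically to the coordinates, so neighbours within
    one coordinate are [m.+1] indices apart. For a point of height [H] the first [j] with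
    [3 * H < expR (T j)] selects a coordinate, and that coordinate alone keeps the point away from
    [x]. *)
Lemma bad_point (R : realType) (m N : nat) (gamma : R) :
  (1 < m)%N -> 1 < gamma -> gamma ^+ m.+1 = m%:R ->
  exists2 x : 'rV[R]_m.+1, irrational_points x &
  forall A, 0 < A -> exists2 eta, 0 < eta & forall r, `|x - ratv R r| < eta ->
    A * expR (- critical_exp m gamma 0 N.+1 (ln (Hmax r)%:R)) <= `|x - ratv R r|.
Proof.
move=> m1 g1 gm; have [T [T0S T2 Too Tcrit]] := barrier_sequence R m N gamma m1 g1 gm.
have T0 k : 0 <= T k by have /andP[] := T0S k.
have TS k : T k <= T k.+1 by have /andP[] := T0S k.
have Tm j k : (j <= k)%N -> T j <= T k.
  move=> /subnKC <-; elim: (k - j)%N => [|n IH]; first by rewrite addn0.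
  by rewrite addnS (le_trans IH).
pose E (i : 'I_m.+1) n := expR (T (n * m.+1 + i)%N).
have E1 i n : 1 <= E i n by rewrite /E -[leLHS]expR0 ler_expR.
have ES i n : 4 * E i n <= E i n.+1.
  rewrite /E; have -> : (n.+1 * m.+1 + i = n * m.+1 + i + m.+1)%N.
    by rewrite mulSn -addnA addnC.
  apply: (@le_trans _ _ (expR (T (n * m.+1 + i)%N + 2))); last by rewrite ler_expR.
  by rewrite expRD mulrC ler_pM2l ?expR_gt0// expR2_ge4.
have [xi xiP] : {xi : 'I_m.+1 -> R & forall i n (r : rat),
    3 * (`|denq r|%N)%:R <= E i n.+1 -> (4 * E i n * E i n.+1)^-1 <= `|xi i - ratr r|}.
  apply: (@choice _ _ (fun i y => forall n (r : rat),
    3 * (`|denq r|%N)%:R <= E i n.+1 ->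
    (4 * E i n * E i n.+1)^-1 <= `|y - ratr r|)) => i.
  exact: badly_approximable.
have Eoo i (b : R) : exists n, b <= E i n.+1.
  have [K _ KP] := Too b; exists K.
  apply: (@le_trans _ _ (T (K.+1 * m.+1 + i)%N)).
    by apply: KP => /=; rewrite mulnS -addnA addSn leqW// leq_addr.
  by apply: le_trans (expR_ge1Dx _); rewrite lerDr.
have irr0 : ~ range (@ratr R) (xi ord0).
  move=> [r _ rE]; have [n nE] := Eoo ord0 (3 * (`|denq r|%N)%:R).
  have := xiP ord0 n r nE; rewrite rE subrr normr0 invr_le0 leNgt.
  by rewrite !mulr_gt0 ?expR_gt0.
exists (\row_i xi i).
  move=> [r _ rE]; apply: irr0; exists (r ord0 ord0) => //.
  by have := congr1 (fun z : 'rV[R]_m.+1 => z ord0 ord0) rE; rewrite !mxE.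
move=> A A0.
have [n1 _ n1P] := Tcrit (ln (4 * A)).
have [eta eta0 far] := rat_far _ _ (Num.bound (expR (T (n1 + m)%N))) irr0.
exists eta => // r rx.
have coord i : (\row_i xi i - ratv R r) ord0 i = xi i - ratr (r ord0 i) by rewrite !mxE.
have HB : expR (T (n1 + m)%N) <= (Hmax r)%:R.
  apply: (@le_trans _ _ (Num.bound (expR (T (n1 + m)%N)))%:R).
    by apply/ltW/archi_boundP/expR_ge0.
  rewrite ler_nat; apply: (@leq_trans `|denq (r ord0 ord0)|%N);
    last exact: (leq_bigmax ord0).
  rewrite leqNgt; apply/negP => /ltnW/far; rewrite leNgt -coord.
  by rewrite (le_lt_trans (row_norm_ge _ _ _ _) rx).
set H : R := (Hmax r)%:R in HB *.
have H0 : 0 < H by apply: lt_le_trans HB; apply: expR_gt0.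
have ex : exists j, 3 * H < expR (T j).
  have [K _ KP] := Too (3 * H); exists K; apply: (le_lt_trans (KP K (leqnn _))).
  by apply: lt_le_trans (expR_ge1Dx _); rewrite ltrDr.
case: (ex_minnP ex) => j jH jmin.
have jn : (n1 + m < j)%N.
  rewrite ltnNge; apply/negP => /Tm; rewrite -ler_expR; move: HB jH; lra.
have kH : expR (T j.-1) <= 3 * H.
  rewrite leNgt; apply/negP => /jmin; rewrite leqNgt prednK ?leqnn//.
  by apply: leq_ltn_trans jn.
pose n := (j - m.+1)%N.
have jE : j = (n + m).+1.
  by rewrite -addnS subnK//; apply: leq_ltn_trans jn; apply: leq_addl.
have n1n : (n1 <= n)%N by move: jn; rewrite jE ltnS leq_add2r.
rewrite jE in jH kH.
have crit := n1P n n1n (ln H).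
have {}crit : T (n + m).+1 + T n + ln (4 * A) <= critical_exp m gamma 0 N.+1 (ln H).
  (* The shift by 2 in [barrier_sequence] is made for the factor 3 of [badly_approximable], as
     [3 <= expR 2]. *)
  apply: crit; apply: ge_expR_ln; rewrite expRB ler_pdivrMr ?expR_gt0//.
  apply: (le_trans kH); rewrite mulrC ler_wpM2l ?(ltW H0)//.
  by apply: le_trans (expR2_ge4 R); rewrite ler_nat.
pose i : 'I_m.+1 := Ordinal (ltn_pmod n (ltn0Sn m)).
have En : E i (n %/ m.+1)%N = expR (T n) by rewrite /E /= -divn_eq.
have En1 : E i (n %/ m.+1).+1 = expR (T (n + m).+1).
  rewrite /E /=; congr (expR (T _)).
  by rewrite mulSn -addnA -divn_eq addSn addnC.
have := xiP i (n %/ m.+1)%N (r ord0 i); rewrite En En1 => low.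
have {}low : (4 * expR (T n) * expR (T (n + m).+1))^-1 <= `|xi i - ratr (r ord0 i)|.
  apply: low; apply: le_trans (ltW jH); rewrite ler_pM2l// ler_nat.
  exact: (leq_bigmax i).
apply: le_trans (row_norm_ge _ _ _ i); rewrite coord; apply: le_trans low.
apply: (@le_trans _ _ (A * expR (- (T (n + m).+1 + T n + ln (4 * A))))).
  by rewrite ler_wpM2l ?(ltW A0)// ler_expR lerN2.
rewrite expRN !expRD lnK ?posrE ?mulr_gt0// le_eqVlt; apply/orP; left; apply/eqP.
by field; rewrite !gt_eqF ?expR_gt0.
Qed.

Lemma logq_le_kappa (R : realType) (kappa kappa' : R) (N : nat) (s : R) :
  kappa <= kappa' -> logq kappa N s <= logq kappa' N s.
Proof.
move=> kk; elim: N s => [//|N IH] s /=.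
by rewrite ler_wpM2r ?invr_ge0 ?sqr_ge0// lerD2l.
Qed.

Lemma inv_log_prod_shift (R : realType) (n : nat) (q : R) :
  inv_log_prod n.+1 q = \prod_(0 <= i < n) (1 / iter_log i (ln (ln q))) ^+ 2.
Proof.
rewrite /inv_log_prod -(addn2 n) -[in LHS](add0n 2%N) big_addn addnK.
by apply: eq_bigr => i _; rewrite addn2 /iter_log !iterSr.
Qed.

(** Writing [C = 1 + 4 * kappa] splits the last coefficient into the regular 1 of the scale and the
    constant at the bottom of [logq]. *)
Lemma inv_log_sum (R : realType) (N : nat) (C q : R) :
  \sum_(2 <= n < N.+2) inv_log_prod n q + C * inv_log_prod N.+2 q =
  4 * logq ((C - 1) / 4) N.+1 (ln (ln q)).
Proof.
rewrite big_add1/=; under eq_bigr do rewrite inv_log_prod_shift.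
rewrite inv_log_prod_shift; move: (ln (ln q)) => {}q.
have PS n v : \prod_(0 <= i < n.+1) (1 / iter_log i (v : R)) ^+ 2 =
    \prod_(0 <= i < n) (1 / iter_log i (ln v)) ^+ 2 / v ^+ 2.
  rewrite big_nat_recl// mulrC {2}/iter_log/= expr_div_n expr1n mul1r.
  by congr (_ / _); apply: eq_bigr => i _; rewrite /iter_log -iterSr.
elim: N q => [|N IH] q.
  by rewrite big_geq// PS big_geq//= add0r; move: (q ^+ 2)^-1 => z; field.
rewrite big_add1/= PS; under eq_bigr do rewrite PS.
rewrite big_nat_recl//= big_geq// mul1r -mulr_suml.
have := IH (ln q); rewrite big_add1 /=.
move: (q ^+ 2)^-1 (\sum_(_ <= _ < _) _) (\prod_(_ <= _ < _) _) (_ / _) => z S P L h.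
have -> : L = (S + C * P) / 4 by rewrite h; field.
by field.
Qed.

(** * The critical function *)

Lemma gamma_d_pow (R : realType) (m : nat) :
  gamma_d R m.+1 ^+ m.+1 = m%:R.
Proof.
have mE : m.+1%:R - 1 = m%:R :> R by rewrite -natr1 addrK.
by rewrite /gamma_d mE -powR_mulrn ?powR_ge0// -powRrM mulVf ?powRr1 ?ler0n.
Qed.

(** For [m = 1] one would get [gamma = 1], and the term in [ln gamma] would vanish. *)
Lemma gamma_d_gt1 (R : realType) (m : nat) : (1 < m)%N -> 1 < gamma_d R m.+1.
Proof.
move=> m1; rewrite ltNge; apply/negP => g1.
have := gamma_d_pow R m; have : gamma_d R m.+1 ^+ m.+1 <= 1.
  by rewrite exprn_ile1// /gamma_d powR_ge0.
by move=> /[swap] ->; rewrite leNgt ltr1n m1.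
Qed.

Lemma omega_dE (R : realType) (m : nat) : (0 < m)%N ->
  omega_d R m.+1 = m.+1%:R * gamma_d R m.+1 / m%:R.
Proof.
move=> m0; have mE : m.+1%:R - 1 = m%:R :> R by rewrite -natr1 addrK.
have m0R : m%:R != 0 :> R by rewrite pnatr_eq0 -lt0n.
rewrite /omega_d /gamma_d mE -mulrA; congr (_ * _).
have -> : - (m%:R / m.+1%:R) = m.+1%:R^-1 - 1 :> R.
  by rewrite -[m.+1%:R]natr1; field; rewrite natr1 pnatr_eq0.
by rewrite powRB ?m0R ?implybT// powRr1 ?ler0n.
Qed.

Lemma psi_NC_critical (R : realType) (m N : nat) (C : R) (q : nat) :
  (0 < m)%N -> (0 < q)%N ->
  psi_NC m.+1 N.+1 C q%:R =
  expR (- critical_exp m (gamma_d R m.+1) ((C - 1) / 4) N.+1 (ln q%:R)).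
Proof.
move=> m0 q0; rewrite /psi_NC inv_log_sum omega_dE// /powR pnatr_eq0 gtn_eqF//.
congr expR; rewrite /critical_exp; field.
by rewrite pnatr_eq0 -lt0n.
Qed.

(** * The liminf in terms of balls *)

Lemma nbhs_row_norm (R : realType) (d : nat) (x : 'rV[R]_d) (U : set 'rV[R]_d) :
  nbhs x U <-> exists2 e, 0 < e & forall y, `|x - y| < e -> U y.
Proof.
split=> [/nbhs_ballP[e /= e0 H]|[e e0 H]].
  by exists e => // y xy; apply: H; rewrite mx_norm_ball.
by apply/nbhs_ballP; exists e => // y; rewrite mx_norm_ball => /H.
Qed.

Lemma approx_const_le0 (R : realType) (d : nat) (H : 'rV[rat]_d -> nat)
    (psi : nat -> R) (x : 'rV[R]_d) :
  (forall delta eta, 0 < delta -> 0 < eta ->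
    exists2 r, `|x - ratv R r| < eta & `|x - ratv R r| / psi (H r) < delta) ->
  (approx_const H psi x <= 0)%E.
Proof.
move=> small; rewrite /approx_const limf_einfE.
apply: ge_ereal_sup => _ [V [U /nbhs_row_norm[eta eta0 HU] UV] <-].
apply/lee_addgt0Pr => delta delta0; rewrite add0e.
have [r r1 r2] := small _ _ delta0 eta0.
apply: (@le_trans _ _ (`|x - ratv R r| / psi (H r))%:E); last by rewrite lee_fin ltW.
by apply: ereal_inf_lbound; exists r => //; apply: UV; apply: HU.
Qed.

Lemma approx_const_eqy (R : realType) (d : nat) (H : 'rV[rat]_d -> nat)
    (psi : nat -> R) (x : 'rV[R]_d) :
  (forall A, 0 < A -> exists2 eta, 0 < eta & forall r, `|x - ratv R r| < eta ->
    A <= `|x - ratv R r| / psi (H r)) ->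
  approx_const H psi x = +oo%E.
Proof.
move=> large; rewrite /approx_const limf_einfE; apply/eqyP => A A0.
have [eta eta0 HA] := large A A0.
apply: (@le_trans _ _ (ereal_inf [set (`|x - ratv R r| / psi (H r))%:E | r in
   (fun r : ratpoint R d => `|x - ratv R r| < eta)])).
  by apply: le_ereal_inf_tmp => _ [r re <-]; rewrite lee_fin HA.
apply: ereal_sup_ubound; exists (fun r : ratpoint R d => `|x - ratv R r| < eta) => //.
exists [set y | `|x - y| < eta]; last by move=> r.
by apply/nbhs_row_norm; exists eta.
Qed.

Theorem theorem1p4 (R : realType) (d : nat) (hd : (3 <= d)%N)
  (N : nat) (hN : (1 <= N)%N) (C : R) (hC : 0 <= C)
  (psi : nat -> R) (psi_gt0 : forall q : nat, (0 < q)%N -> 0 < psi q)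
  (psiE : \forall q \near \oo, psi q = psi_NC d N C q%:R) :
  (dirichlet (@Hmax d) psi <-> 1 < C) /\
  (dirichlet (@Hmax d) psi -> ~ optimally_dirichlet (@Hmax d) psi).
Proof.
case: d hd psiE => // m hm psiE; case: N hN psiE => // N _ psiE.
have m1 : (1 < m)%N by [].
have m0 : (0 < m)%N by apply: ltnW.
have g1 := gamma_d_gt1 R m m1.
have gm := gamma_d_pow R m.
have Hmax_gt0 (r : 'rV[rat]_m.+1) : (0 < Hmax r)%N.
  apply: (@leq_trans `|denq (r ord0 ord0)|%N); last exact: (leq_bigmax ord0).
  by rewrite absz_gt0 denq_neq0.
have {}psiE : \forall q \near \oo,
    psi q = expR (- critical_exp m (gamma_d R m.+1) ((C - 1) / 4) N.+1 (ln q%:R)).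
  near=> q; rewrite -psi_NC_critical//; first by near: q.
  by near: q; apply: nbhs_infty_gt.
have above : 1 < C -> forall x, irrational_points x ->
    (approx_const (@Hmax m.+1) psi x <= 0)%E.
  move=> C1 x irr; apply: approx_const_le0 => delta eta delta0 eta0.
  have k0 : 0 < (C - 1) / 4 by rewrite divr_gt0// subr_gt0.
  have [r r1 r2] := approx_below _ _ _ _ _ _ _ _ _ m0 g1 gm k0 psiE irr delta0 eta0.
  by exists r => //; rewrite ltr_pdivrMr ?psi_gt0.
have below : dirichlet (@Hmax m.+1) psi -> 1 < C.
  move=> dir; rewrite ltNge; apply/negP => C1.
  (* The point built for [kappa = 0] serves every [C <= 1], since a smaller [C] gives a smaller psi;
     the liminf there is infinite. *)
  have [x irr xP] := bad_point R m N _ m1 g1 gm.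
  have := dir x irr; rewrite approx_const_eqy ?ltxx// => A A0.
  have [eta eta0 H] := xP A A0.
  have [M _ MP] := psiE.
  have [i0 irr0] := irrational_coord _ _ _ irr.
  have [eta' eta'0 far] := rat_far _ _ M irr0.
  exists (Num.min eta eta'); first by rewrite lt_min eta0.
  move=> r; rewrite lt_min => /andP[/H h1 h2].
  rewrite ler_pdivlMr ?psi_gt0//; apply: le_trans h1.
  rewrite MP/=; last first.
    apply: (@leq_trans `|denq (r ord0 i0)|%N); last exact: (leq_bigmax i0).
    rewrite leqNgt; apply/negP => /ltnW/far; rewrite leNgt.
    have -> : x ord0 i0 - ratr (r ord0 i0) = (x - ratv R r) ord0 i0 by rewrite !mxE.
    by rewrite (le_lt_trans (row_norm_ge _ _ _ _) h2).
  rewrite ler_wpM2l ?(ltW A0)// ler_expR lerN2.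
  have g0 := lt_trans ltr01 g1.
  apply: ler_wpM2l.
    by rewrite mulr_ge0 ?ln_ge0 ?ler1n// divr_ge0 ?mulr_ge0 ?ler0n// ltW.
  rewrite lerD2l lerN2 ler_wpM2l//.
    by rewrite divr_ge0// (mulr_ge0 (ler0n _ _) (sqr_ge0 _)).
  by apply: logq_le_kappa; lra.
split; first split=> // C1 x irr; first exact: le_lt_trans (above C1 x irr) _.
(* For [C > 1] the liminf is at most 0 at every irrational point, so none can witness optimality. *)
move=> /below C1 [_ [x irr]]; rewrite ltNge; apply/negP; rewrite negbK.
exact: above.
Unshelve. all: by end_near. Qed.
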